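(* Let $\mathfrak g$ be a finite-dimensional simple complex Lie algebra with index set $I$ of simple roots, let $i_1,\dots,i_p,j_1,\dots,j_q\in I$ and let $a_1,\dots,a_p,b_1,\dots,b_q$ be positive integers such that (P1) the sets $\{i_1,\dots,i_p\}$ and $\{j_1,\dots,j_q\}$ form a partition of $I$; (P2) $(\alpha_{i_r},\alpha_{i_s})=0$ for all $1\le r<s\le p$ and $(\alpha_{j_r},\alpha_{j_s})=0$ for all $1\le r<s\le q$; (P3) $3a_k+\sum_{t=1}^q\langle h_{i_k},\alpha_{j_t}\rangle b_t=0$ for $1\le k\le p$; (P4) $b_k+\sum_{t=1}^p\langle h_{j_k},\alpha_{i_t}\rangle a_t=0$ for $1\le k\le q$. Put $$\theta=(f_{i_1}^{(a_1)}\cdots f_{i_p}^{(a_p)})(f_{j_1}^{(b_1)}\cdots f_{j_q}^{(b_q)})(f_{i_1}^{(a_1)}\cdots f_{i_p}^{(a_p)}),$$ $$\xi=(f_{i_1}^{(a_1)}\cdots f_{i_p}^{(a_p)})(f_{j_1}^{(b_1)}\cdots f_{j_q}^{(b_q)})(f_{i_1}^{(2a_1)}\cdots f_{i_p}^{(2a_p)})(f_{j_1}^{(b_1)}\cdots f_{j_q}^{(b_q)})(f_{i_1}^{(a_1)}\cdots f_{i_p}^{(a_p)})$$ in $U_q^-(\mathfrak g)$. Then (with the numbering of the simple roots described in the context, and up to the order of the mutually commuting factors inside each pair of parentheses) the triple $(\mathfrak g,\theta,\xi)$ belongs to one of the following 10 families, for some positive integer $l$: 1. $A_5$: $\theta_1^{[l]}=(f_2^{(l)}f_4^{(l)})(f_1^{(l)}f_3^{(2l)}f_5^{(l)})(f_2^{(l)}f_4^{(l)})$,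 $\xi_1^{[l]}=(f_2^{(l)}f_4^{(l)})(f_1^{(l)}f_3^{(2l)}f_5^{(l)})(f_2^{(2l)}f_4^{(2l)})(f_1^{(l)}f_3^{(2l)}f_5^{(l)})(f_2^{(l)}f_4^{(l)})$. 2. $A_5$: $\theta_2^{[l]}=(f_1^{(l)}f_3^{(2l)}f_5^{(l)})(f_2^{(3l)}f_4^{(3l)})(f_1^{(l)}f_3^{(2l)}f_5^{(l)})$, $\xi_2^{[l]}=(f_1^{(l)}f_3^{(2l)}f_5^{(l)})(f_2^{(3l)}f_4^{(3l)})(f_1^{(2l)}f_3^{(4l)}f_5^{(2l)})(f_2^{(3l)}f_4^{(3l)})(f_1^{(l)}f_3^{(2l)}f_5^{(l)})$. 3. $B_3$: $\theta_3^{[l]}=f_2^{(l)}(f_1^{(l)}f_3^{(2l)})f_2^{(l)}$, $\xi_3^{[l]}=f_2^{(l)}(f_1^{(l)}f_3^{(2l)})f_2^{(2l)}(f_1^{(l)}f_3^{(2l)})f_2^{(l)}$. 4. $B_3$: $\theta_4^{[l]}=(f_1^{(l)}f_3^{(2l)})f_2^{(3l)}(f_1^{(l)}f_3^{(2l)})$, $\xi_4^{[l]}=(f_1^{(l)}f_3^{(2l)})f_2^{(3l)}(f_1^{(2l)}f_3^{(4l)})f_2^{(3l)}(f_1^{(l)}f_3^{(2l)})$. 5. $C_3$: $\theta_5^{[l]}=f_2^{(l)}(f_1^{(l)}f_3^{(l)})f_2^{(l)}$, $\xi_5^{[l]}=f_2^{(l)}(f_1^{(l)}f_3^{(l)})f_2^{(2l)}(f_1^{(l)}f_3^{(l)})f_2^{(l)}$.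 6. $C_3$: $\theta_6^{[l]}=(f_1^{(l)}f_3^{(l)})f_2^{(3l)}(f_1^{(l)}f_3^{(l)})$, $\xi_6^{[l]}=(f_1^{(l)}f_3^{(l)})f_2^{(3l)}(f_1^{(2l)}f_3^{(2l)})f_2^{(3l)}(f_1^{(l)}f_3^{(l)})$. 7. $D_4$: $\theta_7^{[l]}=f_2^{(l)}(f_1^{(l)}f_3^{(l)}f_4^{(l)})f_2^{(l)}$, $\xi_7^{[l]}=f_2^{(l)}(f_1^{(l)}f_3^{(l)}f_4^{(l)})f_2^{(2l)}(f_1^{(l)}f_3^{(l)}f_4^{(l)})f_2^{(l)}$. 8. $D_4$: $\theta_8^{[l]}=(f_1^{(l)}f_3^{(l)}f_4^{(l)})f_2^{(3l)}(f_1^{(l)}f_3^{(l)}f_4^{(l)})$, $\xi_8^{[l]}=(f_1^{(l)}f_3^{(l)}f_4^{(l)})f_2^{(3l)}(f_1^{(2l)}f_3^{(2l)}f_4^{(2l)})f_2^{(3l)}(f_1^{(l)}f_3^{(l)}f_4^{(l)})$. 9. $G_2$: $\theta_9^{[l]}=f_1^{(l)}f_2^{(l)}f_1^{(l)}$, $\xi_9^{[l]}=f_1^{(l)}f_2^{(l)}f_1^{(2l)}f_2^{(l)}f_1^{(l)}$. 10. $G_2$: $\theta_{10}^{[l]}=f_2^{(l)}f_1^{(3l)}f_2^{(l)}$, $\xi_{10}^{[l]}=f_2^{(l)}f_1^{(3l)}f_2^{(2l)}f_1^{(3l)}f_2^{(l)}$.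
   Context: $\alpha_i$, $h_i$ ($i\in I$) are the simple roots and simple coroots, $(\langle h_i,\alpha_j\rangle)_{ij}$ is the Cartan matrix of $\mathfrak g$, and $(\cdot,\cdot)$ is an invariant symmetric form with $\langle h_i,\lambda\rangle=2(\alpha_i,\lambda)/(\alpha_i,\alpha_i)$ and $(\alpha_i,\alpha_i)\in2\mathbb Z_{>0}$. $U_q^-(\mathfrak g)$ is the negative part of the quantized enveloping algebra: the $\mathbb Q(q)$-algebra generated by $f_i$ ($i\in I$) with the quantum Serre relations; $f_i^{(n)}=f_i^n/[n]_i!$ is the divided power, with $[n]_i=(q_i^n-q_i^{-n})/(q_i-q_i^{-1})$, $q_i=q^{(\alpha_i,\alpha_i)/2}$. The indices $i_1,\dots,i_p$ are pairwise distinct and so are $j_1,\dots,j_q$. Numbering: $A_5$ is the path $1-2-3-4-5$; $B_3$ and $C_3$ are paths $1-2-3$ with $\alpha_3$ the short root in $B_3$ ($\langle h_3,\alpha_2\rangle=-2$) and $\alpha_3$ the long root in $C_3$ ($\langle h_2,\alpha_3\rangle=-2$); in $D_4$ the node $2$ is the central node; in $G_2$, $\alpha_1$ is the short root ($\langle h_1,\alpha_2\rangle=-3$, $\langle h_2,\alpha_1\rangle=-1$). *)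

(* Defs.v *)
From HB Require Import structures.
From mathcomp Require Import all_boot all_order all_algebra.
From mathcomp Require Import boolp reals.
From mathcomp Require Import complex.
From mathcomp Require Import finmap monalg.

Set Implicit Arguments.
Unset Strict Implicit.
Unset Printing Implicit Defensive.

Import GRing.Theory Num.Theory.
Local Open Scope ring_scope.

HB.mixin Record isLieAlgebra (K : fieldType) g of Vector K g := {
  bracket : g -> g -> g;
  bracket_linearl : forall y, linear (bracket^~ y);
  bracket_linearr : forall x, linear (bracket x);
  bracket_alt : forall x, bracket x x = 0;
  bracket_jacobi : forall x y z,
    bracket x (bracket y z) + bracket y (bracket z x)
      + bracket z (bracket x y) = 0
}.

#[short(type="lieAlgType")]
HB.structure Definition LieAlgebra (K : fieldType) :=
  {g of isLieAlgebra K g & Vector K g}.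

Section LieAlgebra.
Variables (K : fieldType) (g : lieAlgType K).

Definition is_ideal (U : {vspace g}) :=
  forall x u, u \in U -> bracket x u \in U.

Definition simple_lie :=
  (exists x y : g, bracket x y != 0) /\
  (forall U : {vspace g}, is_ideal U -> U = 0%VS \/ U = fullv).

Definition ad_diagonalizable (x : g) :=
  exists X : seq g, basis_of fullv X /\
    forall v, v \in X -> exists c : K, bracket x v = c *: v.

(* The definition adapted to semisimple Lie algebras: abelian, equal to its own
   centraliser, and acting by ad-diagonalizable elements. *)
Definition cartan_subalgebra (H : {vspace g}) :=
  [/\ (forall x y, x \in H -> y \in H -> bracket x y = 0),
      (forall x, (forall y, y \in H -> bracket y x = 0) -> x \in H)
    & (forall x, x \in H -> ad_diagonalizable x)].

Variable H : {vspace g}.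

Definition dual := 'Hom(subvs_of H, K^o).
HB.instance Definition _ := Vector.on dual.


Definition root_space (beta : dual) (x : g) :=
  forall t : subvs_of H, bracket (vsval t) x = (beta t : K) *: x.

Definition is_root (beta : dual) :=
  beta != 0 /\ exists2 x, x != 0 & root_space beta x.

Variable I : finType.

Definition simple_roots (alpha : I -> dual) :=
  [/\ basis_of fullv (codom alpha),
      (forall i, is_root (alpha i))
    & (forall beta, is_root beta -> exists m : I -> nat,
         beta = \sum_i alpha i *+ m i \/ beta = - \sum_i alpha i *+ m i)].

(* [t] is the coroot of [beta], i.e. the semisimple element of an sl2-triple
   through the root spaces of [beta] and [- beta]. *)
Definition is_coroot (beta : dual) (t : subvs_of H) :=
  beta t = 2%:R /\
  exists e f : g, [/\ root_space beta e, root_space (- beta) f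
                    & vsval t = bracket e f].

(* <h_i, alpha_j> *)
Definition pairing (alpha : I -> dual) (h : I -> subvs_of H) (i j : I) : K :=
  alpha j (h i).

(* [form] is invariant under the Weyl group and normalised by
   (alpha_i, alpha_i) = 2 d_i with d_i a positive integer. *)
Definition invariant_form (alpha : I -> dual) (h : I -> subvs_of H)
    (form : {symmetric dual}) (d : I -> nat) :=
  [/\ (forall i (x y : dual),
         form (x - (x (h i) : K) *: alpha i) (y - (y (h i) : K) *: alpha i)
         = form x y),
      (forall i (x : dual),
         x (h i) = 2%:R * form (alpha i) x / form (alpha i) (alpha i))
    & (forall i, (0 < d i)%N /\ form (alpha i) (alpha i) = (2 * d i)%:R)].

End LieAlgebra.

Definition Qq : fieldType := {fraction {poly rat}}.
Definition qvar : Qq := tofrac 'X.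

(* The quantum integer [n]_i and its factorial, with q_i = q ^ d. *)
Definition qnum (d n : nat) : Qq :=
  ((qvar ^+ d) ^+ n - (qvar ^+ d) ^- n) / (qvar ^+ d - (qvar ^+ d)^-1).

Definition qfact (d n : nat) : Qq := \prod_(1 <= k < n.+1) qnum d k.

(* The algebra of the free monoid on [I], i.e. the free associative algebra. *)
Notation free_alg I := {malg Qq[{fmonom I}]}.

Fact free_scaleAr (I : finType) (a : Qq) (x y : free_alg I) :
  a *: (x * y) = x * (a *: y).
Proof.
have sub_supp : (msupp (a *: y) `<=` msupp y)%fset by exact: msuppZ_le.
apply/malgP=> k; rewrite mcoeffZ mcoeffMl.
rewrite (mcoeffMlw _ (fsubset_refl _) sub_supp).
rewrite mulr_sumr; apply: eq_bigr => k1 _; rewrite mulr_sumr.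
by apply: eq_bigr => k2 _; rewrite mcoeffZ mulrnAr mulrCA.
Qed.

Section NegativePart.
Variables (K : nzRingType) (I : finType).
(* [c i j] is <h_i, alpha_j> and [d i] is (alpha_i, alpha_i) / 2. *)
Variables (c : I -> I -> K) (d : I -> nat).

Definition letter (i : I) : free_alg I := << fmu i >>.

Definition free_dpow (i : I) (n : nat) : free_alg I :=
  (qfact (d i) n)^-1 *: letter i ^+ n.

Definition serre_rel (i j : I) (n : nat) : free_alg I :=
  \sum_(k < n.+1) (-1) ^+ k *: (free_dpow i k * letter j * free_dpow i (n - k)).

(* The two-sided ideal of the quantum Serre relations; [n] is
   1 - <h_i, alpha_j>. *)
Inductive serre_ideal : free_alg I -> Prop :=
| Serre0 : serre_ideal 0
| SerreD x y : serre_ideal x -> serre_ideal y -> serre_ideal (x + y)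
| SerreM x y z : serre_ideal y -> serre_ideal (x * y * z)
| SerreRel i j n of i != j & n%:R = 1 - c i j : serre_ideal (serre_rel i j n).

Definition serre_pred : {pred free_alg I} := fun x => `[< serre_ideal x >].

Fact serre_zmod_closed : zmod_closed serre_pred.
Proof.
split=> [|x y /asboolP Ix /asboolP Iy]; apply/asboolP; first exact: Serre0.
apply: SerreD => //; rewrite -[- y]mulr1 -mulN1r; exact: SerreM.
Qed.
HB.instance Definition _ :=
  GRing.isZmodClosed.Build (free_alg I) serre_pred serre_zmod_closed.

Definition Uqm := Quotient.quot serre_pred.
HB.instance Definition _ := EqQuotient.on Uqm.
HB.instance Definition _ := GRing.Zmodule.on Uqm.

Local Open Scope quotient_scope.

Local Notation pi := (\pi_Uqm).

Lemma Uqm_eqP (x y : free_alg I) : pi x = pi y <-> serre_ideal (x - y).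
Proof.
split=> [/eqP|Ixy]; rewrite -?Quotient.idealrBE; first by move/asboolP.
by apply/eqP; rewrite -Quotient.idealrBE; apply/asboolP.
Qed.

Lemma pi_repr (x : free_alg I) : serre_ideal (x - repr (pi x)).
Proof. by apply/Uqm_eqP; rewrite reprK. Qed.

Definition Uqm_one : Uqm := pi 1.
Definition Uqm_mul (x y : Uqm) : Uqm := pi (repr x * repr y).
Definition Uqm_scale (a : Qq) (x : Uqm) : Uqm := pi (a *: repr x).

Lemma pi_mul (x y : free_alg I) : pi (x * y) = Uqm_mul (pi x) (pi y).
Proof.
apply/Uqm_eqP; set x' := repr _; set y' := repr _.
have -> : x * y - x' * y' = 1 * (x - x') * y + x' * (y - y') * 1.
  by rewrite mul1r mulr1 mulrBl mulrBr addrA subrK.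
by apply: SerreD; apply: SerreM; apply: pi_repr.
Qed.

Lemma pi_scale a (x : free_alg I) : pi (a *: x) = Uqm_scale a (pi x).
Proof.
apply/Uqm_eqP; rewrite -scalerBr -mul_malgC -[X in serre_ideal X]mulr1.
exact/SerreM/pi_repr.
Qed.

Lemma piD (x y : free_alg I) : pi (x + y) = pi x + pi y.
Proof. exact: raddfD. Qed.

Lemma Uqm_ind (P : Uqm -> Prop) : (forall x, P (pi x)) -> forall x, P x.
Proof. by move=> Ppi x; rewrite -[x]reprK. Qed.

Fact Uqm_mulA : associative Uqm_mul.
Proof.
by elim/Uqm_ind=> x; elim/Uqm_ind=> y; elim/Uqm_ind=> z; rewrite -!pi_mul mulrA.
Qed.

Fact Uqm_mul1 : left_id Uqm_one Uqm_mul.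
Proof. by elim/Uqm_ind=> x; rewrite -pi_mul mul1r. Qed.

Fact Uqm_mulr1 : right_id Uqm_one Uqm_mul.
Proof. by elim/Uqm_ind=> x; rewrite -pi_mul mulr1. Qed.

Fact Uqm_mulDl : left_distributive Uqm_mul +%R.
Proof.
elim/Uqm_ind=> x; elim/Uqm_ind=> y; elim/Uqm_ind=> z.
by rewrite -!pi_mul -!piD -pi_mul mulrDl.
Qed.

Fact Uqm_mulDr : right_distributive Uqm_mul +%R.
Proof.
elim/Uqm_ind=> x; elim/Uqm_ind=> y; elim/Uqm_ind=> z.
by rewrite -!pi_mul -!piD -pi_mul mulrDr.
Qed.

Lemma serre_ideal_augm x : serre_ideal x -> x@_(mone : {fmonom I}) = 0.
Proof.
elim=> {x} [|x y _ x0 _ y0|x y z _ y0|i j n _ _].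
- exact: mcoeff0.
- by rewrite mcoeffD x0 y0 addr0.
- by rewrite !rmorphM /= y0 mulr0 mul0r.
have letter0 : (letter j)@_(mone : {fmonom I}) = 0.
  by rewrite mcoeffU1; case: eqP => // /eqP; rewrite fmP fm1 fmuE.
rewrite raddf_sum big1 // => k _.
by rewrite /= mcoeffZ !rmorphM /= letter0 mulr0 mul0r mulr0.
Qed.

Fact Uqm_one_neq0 : Uqm_one != 0.
Proof.
apply/eqP; rewrite -(raddf0 pi) => /Uqm_eqP; rewrite subr0.
by move/serre_ideal_augm/eqP; rewrite rmorph1 oner_eq0.
Qed.

HB.instance Definition _ := GRing.Zmodule_isNzRing.Build Uqm
  Uqm_mulA Uqm_mul1 Uqm_mulr1 Uqm_mulDl Uqm_mulDr Uqm_one_neq0.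

Fact Uqm_scaleA a b (x : Uqm) :
  Uqm_scale a (Uqm_scale b x) = Uqm_scale (a * b) x.
Proof. by elim/Uqm_ind: x => x; rewrite -!pi_scale scalerA. Qed.

Fact Uqm_scale1 : left_id 1 Uqm_scale.
Proof. by elim/Uqm_ind=> x; rewrite -pi_scale scale1r. Qed.

Fact Uqm_scaleDr : right_distributive Uqm_scale +%R.
Proof.
move=> a; elim/Uqm_ind=> x; elim/Uqm_ind=> y.
by rewrite -!(piD, pi_scale) scalerDr.
Qed.

Fact Uqm_scaleDl x : {morph Uqm_scale^~ x : a b / a + b}.
Proof.
by move=> a b; elim/Uqm_ind: x => x; rewrite -!(piD, pi_scale) scalerDl.
Qed.

HB.instance Definition _ := GRing.Zmodule_isLmodule.Build Qq Uqm
  Uqm_scaleA Uqm_scale1 Uqm_scaleDr Uqm_scaleDl.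

Fact Uqm_scaleAl a (x y : Uqm) :
  Uqm_scale a (Uqm_mul x y) = Uqm_mul (Uqm_scale a x) y.
Proof.
elim/Uqm_ind: x => x; elim/Uqm_ind: y => y.
by rewrite -pi_mul -!pi_scale -pi_mul fgscaleAl.
Qed.
HB.instance Definition _ :=
  GRing.LSemiModule_isLSemiAlgebra.Build Qq Uqm Uqm_scaleAl.

Fact Uqm_scaleAr a (x y : Uqm) :
  Uqm_scale a (Uqm_mul x y) = Uqm_mul x (Uqm_scale a y).
Proof.
elim/Uqm_ind: x => x; elim/Uqm_ind: y => y.
by rewrite -pi_mul -!pi_scale -pi_mul free_scaleAr.
Qed.
HB.instance Definition _ :=
  GRing.LSemiAlgebra_isSemiAlgebra.Build Qq Uqm Uqm_scaleAr.

Definition gen (i : I) : Uqm := pi (letter i).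
Definition dpow (i : I) (n : nat) : Uqm := (qfact (d i) n)^-1 *: gen i ^+ n.

Definition dmono (p : nat) (i : 'I_p -> I) (a : 'I_p -> nat) : Uqm :=
  \prod_(k < p) dpow (i k) (a k).

(* [numbering M s]: the node numbered [r] is [s r], with nodes numbered from 1
   to [size M], and the [r]-th row of [M] lists <h_r, alpha_1>, <h_r, alpha_2>,
   etc. Values of [s] outside this range are irrelevant. *)
Definition numbering (M : seq (seq int)) (s : nat -> I) :=
  [/\ {in [pred r | 1 <= r <= size M]%N &, injective s},
      (forall i, exists2 r, (1 <= r <= size M)%N & s r = i)
    & (forall r t, (1 <= r <= size M)%N -> (1 <= t <= size M)%N ->
         c (s r) (s t) = (nth 0 (nth [::] M r.-1) t.-1)%:~R)].

Definition cartan_A5 : seq (seq int) :=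
  [:: [::  2; -1;  0;  0;  0];
      [:: -1;  2; -1;  0;  0];
      [::  0; -1;  2; -1;  0];
      [::  0;  0; -1;  2; -1];
      [::  0;  0;  0; -1;  2] ].
Definition cartan_B3 : seq (seq int) :=
  [:: [::  2; -1;  0];
      [:: -1;  2; -1];
      [::  0; -2;  2] ].
Definition cartan_C3 : seq (seq int) :=
  [:: [::  2; -1;  0];
      [:: -1;  2; -2];
      [::  0; -1;  2] ].
Definition cartan_D4 : seq (seq int) :=
  [:: [::  2; -1;  0;  0];
      [:: -1;  2; -1; -1];
      [::  0; -1;  2;  0];
      [::  0; -1;  0;  2] ].
Definition cartan_G2 : seq (seq int) :=
  [:: [::  2; -3];
      [:: -1;  2] ].

Definition f_ (s : nat -> I) (r n : nat) : Uqm := dpow (s r) n.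

(* The factors inside each pair of parentheses commute in [Uqm], so equality
   there does not see their order. *)
Inductive listed (theta xi : Uqm) : Prop :=
| Family1 s l of numbering cartan_A5 s & (0 < l)%N
  & theta =
      (f_ s 2 l * f_ s 4 l)
      * (f_ s 1 l * f_ s 3 (2 * l) * f_ s 5 l)
      * (f_ s 2 l * f_ s 4 l)
  & xi =
      (f_ s 2 l * f_ s 4 l)
      * (f_ s 1 l * f_ s 3 (2 * l) * f_ s 5 l)
      * (f_ s 2 (2 * l) * f_ s 4 (2 * l))
      * (f_ s 1 l * f_ s 3 (2 * l) * f_ s 5 l)
      * (f_ s 2 l * f_ s 4 l)
| Family2 s l of numbering cartan_A5 s & (0 < l)%N
  & theta =
      (f_ s 1 l * f_ s 3 (2 * l) * f_ s 5 l)
      * (f_ s 2 (3 * l) * f_ s 4 (3 * l))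
      * (f_ s 1 l * f_ s 3 (2 * l) * f_ s 5 l)
  & xi =
      (f_ s 1 l * f_ s 3 (2 * l) * f_ s 5 l)
      * (f_ s 2 (3 * l) * f_ s 4 (3 * l))
      * (f_ s 1 (2 * l) * f_ s 3 (4 * l) * f_ s 5 (2 * l))
      * (f_ s 2 (3 * l) * f_ s 4 (3 * l))
      * (f_ s 1 l * f_ s 3 (2 * l) * f_ s 5 l)
| Family3 s l of numbering cartan_B3 s & (0 < l)%N
  & theta =
      f_ s 2 l * (f_ s 1 l * f_ s 3 (2 * l)) * f_ s 2 l
  & xi =
      f_ s 2 l * (f_ s 1 l * f_ s 3 (2 * l))
      * f_ s 2 (2 * l)
      * (f_ s 1 l * f_ s 3 (2 * l)) * f_ s 2 l
| Family4 s l of numbering cartan_B3 s & (0 < l)%N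
  & theta =
      (f_ s 1 l * f_ s 3 (2 * l)) * f_ s 2 (3 * l) * (f_ s 1 l * f_ s 3 (2 * l))
  & xi =
      (f_ s 1 l * f_ s 3 (2 * l)) * f_ s 2 (3 * l)
      * (f_ s 1 (2 * l) * f_ s 3 (4 * l))
      * f_ s 2 (3 * l) * (f_ s 1 l * f_ s 3 (2 * l))
| Family5 s l of numbering cartan_C3 s & (0 < l)%N
  & theta =
      f_ s 2 l * (f_ s 1 l * f_ s 3 l) * f_ s 2 l
  & xi =
      f_ s 2 l * (f_ s 1 l * f_ s 3 l)
      * f_ s 2 (2 * l)
      * (f_ s 1 l * f_ s 3 l) * f_ s 2 l
| Family6 s l of numbering cartan_C3 s & (0 < l)%N
  & theta =
      (f_ s 1 l * f_ s 3 l) * f_ s 2 (3 * l) * (f_ s 1 l * f_ s 3 l)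
  & xi =
      (f_ s 1 l * f_ s 3 l) * f_ s 2 (3 * l)
      * (f_ s 1 (2 * l) * f_ s 3 (2 * l))
      * f_ s 2 (3 * l) * (f_ s 1 l * f_ s 3 l)
| Family7 s l of numbering cartan_D4 s & (0 < l)%N
  & theta =
      f_ s 2 l
      * (f_ s 1 l * f_ s 3 l * f_ s 4 l)
      * f_ s 2 l
  & xi =
      f_ s 2 l
      * (f_ s 1 l * f_ s 3 l * f_ s 4 l)
      * f_ s 2 (2 * l)
      * (f_ s 1 l * f_ s 3 l * f_ s 4 l)
      * f_ s 2 l
| Family8 s l of numbering cartan_D4 s & (0 < l)%N
  & theta =
      (f_ s 1 l * f_ s 3 l * f_ s 4 l)
      * f_ s 2 (3 * l)
      * (f_ s 1 l * f_ s 3 l * f_ s 4 l)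
  & xi =
      (f_ s 1 l * f_ s 3 l * f_ s 4 l)
      * f_ s 2 (3 * l)
      * (f_ s 1 (2 * l) * f_ s 3 (2 * l) * f_ s 4 (2 * l))
      * f_ s 2 (3 * l)
      * (f_ s 1 l * f_ s 3 l * f_ s 4 l)
| Family9 s l of numbering cartan_G2 s & (0 < l)%N
  & theta =
      f_ s 1 l * f_ s 2 l * f_ s 1 l
  & xi =
      f_ s 1 l * f_ s 2 l
      * f_ s 1 (2 * l)
      * f_ s 2 l * f_ s 1 l
| Family10 s l of numbering cartan_G2 s & (0 < l)%N
  & theta =
      f_ s 2 l * f_ s 1 (3 * l) * f_ s 2 l
  & xi =
      f_ s 2 l * f_ s 1 (3 * l)
      * f_ s 2 (2 * l)
      * f_ s 1 (3 * l) * f_ s 2 l.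

End NegativePart.

Arguments gen {K I} c d i.
Arguments dpow {K I} c d i n.
Arguments dmono {K I} c d {p} i a.
Arguments f_ {K I} c d s r n.
Arguments listed {K I} c d theta xi.

(* Main.v *)
Require Import Defs.
From HB Require Import structures.
From mathcomp Require Import all_boot all_order all_algebra.
From mathcomp Require Import boolp reals.
From mathcomp Require Import complex.
From mathcomp Require Import monalg ring zify.

(* Record the Cartan integers as [<h_u, alpha_v> = - n u v] and put
   [kap = 3] on the [i]-nodes and [kap = 1] on the [j]-nodes. Then (P3) and (P4)
   say [kap v * x v = \sum_u n v u * x u] for one positive vector [x], and [kap]
   multiplies to [3] along every edge, so applying [n] twice multiplies [x] by
   [3]. Comparing coefficients of [x v], the weight [\sum_u n v u * n u v] of a
   node is at most [3], with equality only for the centre of a star (D4, B3, C3,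
   G2); if all weights are at most [2] the graph is a path, and walking from a
   leaf shows that it is A5 with forced values of [x].
   The Lie theory needed is that the [n u v] are naturals, and that the diagram
   is connected: if a set [S] of nodes were orthogonal to its complement, a root
   of minimal height meeting both sides would contradict sl2-theory, so there is
   none, and the elements commuting with all root spaces not supported in [S]
   form a proper nonzero ideal. *)

Set Implicit Arguments.
Unset Strict Implicit.
Unset Printing Implicit Defensive.

Import Order.TTheory GRing.Theory Num.Theory.

(** * The diagram and the positive vector *)

Lemma mul_eq3 k l : k * l = 3 -> k = 3 /\ l = 1 \/ k = 1 /\ l = 3.
Proof. by case: k => [|[|[|[|k]]]]; case: l => [|[|[|[|l]]]] //; nia. Qed.

Lemma mul_eq2 k l : k * l = 2 -> k = 2 /\ l = 1 \/ k = 1 /\ l = 2.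
Proof. by case: k => [|[|[|k]]]; case: l => [|[|[|l]]] //; nia. Qed.

Lemma mul_eq1 k l : k * l = 1 -> k = 1 /\ l = 1.
Proof. by move/eqP; rewrite muln_eq1 => /andP[/eqP-> /eqP->]. Qed.

Section DoubledEigenvector.
Variables (I : finType) (n : I -> I -> nat) (kap x : I -> nat).
Hypotheses (n_sym0 : forall u v, n u v = 0 -> n v u = 0)
  (x_gt0 : forall v, 0 < x v)
  (kap_adj : forall u v, 0 < n u v -> kap u * kap v = 3)
  (x_eq : forall v, kap v * x v = \sum_u n v u * x u)
  (kap_gt0 : forall v, 0 < kap v)
  (conn : forall S : {set I}, S != set0 ->
     (forall u v, u \in S -> 0 < n u v -> v \in S) -> S = setT).

Definition nbrs v := enum [pred u | 0 < n v u].

Lemma mem_nbrs v u : (u \in nbrs v) = (0 < n v u).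
Proof. by rewrite mem_enum inE. Qed.

Lemma nbrs_uniq v : uniq (nbrs v). Proof. exact: enum_uniq. Qed.

Lemma n_sym_gt0 u v : (0 < n u v) = (0 < n v u).
Proof. by rewrite !lt0n; congr negb; apply/eqP/eqP=> /n_sym0. Qed.

Lemma nbrs_sym u v : (u \in nbrs v) = (v \in nbrs u).
Proof. by rewrite !mem_nbrs n_sym_gt0. Qed.

Lemma n_diag v : n v v = 0.
Proof. by apply/eqP; rewrite eqn0Ngt; apply/negP=> /kap_adj; case: (kap v) => [|[|k]] //; nia. Qed.

Lemma kap_cases u v : u \in nbrs v ->
  kap v = 3 /\ kap u = 1 \/ kap v = 1 /\ kap u = 3.
Proof.
by rewrite mem_nbrs => /kap_adj/mul_eq3.
Qed.

Lemma sum_nbrs v F : \sum_u n v u * F u = \sum_(u <- nbrs v) n v u * F u.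
Proof.
rewrite /nbrs big_enum [RHS]big_mkcond /=.
by apply: eq_bigr => u _; rewrite inE; case: posnP => // ->.
Qed.

Lemma x_nbrs v : kap v * x v = \sum_(u <- nbrs v) n v u * x u.
Proof. by rewrite x_eq sum_nbrs. Qed.

Lemma nbrs_neq0 v : nbrs v != [::].
Proof.
apply/eqP=> nv0; have := x_nbrs v; rewrite nv0 big_nil.
by have := x_gt0 v; have := kap_gt0 v; nia.
Qed.

(** All neighbours [u] of [v] share the value [kap u = 3 / kap v]. Multiplying [x_eq] at [v] by it
    and expanding [kap u * x u] by [x_eq] again gives a double sum over walks of length two; the
    walks returning to [v] are split off. *)
Lemma two_step v : 3 * x v
  = \sum_u n v u * n u v * x v + \sum_u n v u * \sum_(t | t != v) n u t * x t.
Proof.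
transitivity (\sum_u n v u * (kap u * x u)).
  case nvE: (nbrs v) (nbrs_neq0 v) => [//|u0 s] _.
  have nu0 : 0 < n v u0 by rewrite -mem_nbrs nvE mem_head.
  have -> : 3 * x v = kap u0 * (kap v * x v) by rewrite mulnA [kap u0 * _]mulnC kap_adj.
  rewrite x_eq big_distrr /=; apply: eq_bigr => u _.
  case: (posnP (n v u)) => [->|nvu]; first by rewrite !mul0n muln0.
  rewrite mulnCA; congr (_ * (_ * _)).
  by have := kap_adj nvu; have := kap_adj nu0; have := kap_gt0 v; nia.
rewrite -big_split /=; apply: eq_bigr => u _.
by rewrite x_eq (bigD1 v) //= mulnDr mulnA.
Qed.

(* The graph with weights [n] has spectral radius [sqrt 3 < 2]; since
   [sqrt 3 < 7 / 4 < 2], rescaling one colour class by [7 / 4] makes every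
   inequality below strict. *)
Definition rescaled v := (if kap v == 3 then 7 else 4) * x v.

Lemma rescaled_gt0 v : 0 < rescaled v.
Proof. by rewrite /rescaled; have := x_gt0 v; case: ifP; lia. Qed.

Lemma rescaled_sub v : \sum_(u | u != v) n v u * rescaled u < 2 * rescaled v.
Proof.
have <- : \sum_u n v u * rescaled u = \sum_(u | u != v) n v u * rescaled u.
  by rewrite (bigD1 v) //= n_diag.
have kap_v : kap v = 3 \/ kap v = 1.
  case E: (nbrs v) (nbrs_neq0 v) => [//|u s] _.
  by have := @kap_cases u v; rewrite E mem_head => /(_ isT); lia.
have -> : \sum_u n v u * rescaled u = (if kap v == 3 then 4 else 7) * (kap v * x v).
  rewrite x_nbrs sum_nbrs big_distrr /= !big_seq; apply: eq_bigr => u uv.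
  rewrite /rescaled mulnCA; congr (_ * _).
  by case: (kap_cases uv) => -[-> ->].
by rewrite /rescaled; have := x_gt0 v; case: kap_v => -> /=; lia.
Qed.

Lemma weight_le3 v : \sum_(u <- nbrs v) n v u * n u v <= 3.
Proof.
have := two_step v; rewrite -sum_nbrs -big_distrl /=.
have := x_gt0 v; nia.
Qed.

(** When the returning walks in [two_step] already account for [3 * x v], the remaining sum of
    nonnegative terms is zero. As [x] is positive, no walk of length two leaves [v] for another
    node. *)
Lemma weight_eq3 v u : \sum_(u <- nbrs v) n v u * n u v = 3 ->
  u \in nbrs v -> nbrs u = [:: v].
Proof.
move=> w3 uv; have := two_step v; rewrite -big_distrl /= sum_nbrs w3.
move/eqP; rewrite -[X in X == _]addn0 eqn_add2l eq_sym sum_nat_eq0.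
move/forall_inP/(_ u isT); rewrite muln_eq0 sum_nat_eq0.
move: (uv); rewrite mem_nbrs lt0n => /negPf-> /= /forall_inP nu0.
apply: perm_small_eq => //; apply: uniq_perm => // [|t]; first exact: nbrs_uniq.
rewrite inE; have [->|tv] := eqVneq t v; first by rewrite nbrs_sym.
have := nu0 t tv; rewrite muln_eq0 => /orP[/eqP nut|/eqP xt].
  by rewrite mem_nbrs nut.
by have := x_gt0 t; rewrite xt.
Qed.

(** This is how connectedness enters: a list of nodes found by exploring neighbours exhausts the
    diagram once it is closed. *)
Lemma full_seq (L : seq I) : L != [::] ->
  (forall u, u \in L -> {subset nbrs u <= L}) -> L =i predT.
Proof.
case: L => [//|v L] _ Lclosed u; set L' := v :: L in Lclosed *.
have /setP/(_ u) : [set w in L'] = setT; last by rewrite !inE.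
apply: conn => [|w t]; first by apply/set0Pn; exists v; rewrite inE mem_head.
by rewrite !inE => /Lclosed sub; rewrite -mem_nbrs => /sub.
Qed.

Lemma nbrs_n0 v t : t \notin nbrs v -> n v t = 0.
Proof. by rewrite mem_nbrs -eqn0Ngt => /eqP. Qed.

(** Only off-diagonal entries are compared, since [n] vanishes on the diagonal ([n_diag]) where a
    Cartan matrix has 2. The node [v0] is a mere default value for [nth]. *)
Definition realizes (M : seq (seq int)) (L : seq I) :=
  [/\ uniq L, L =i predT, size L = size M
    & forall v0 r t, r < size M -> t < size M -> r != t ->
      Posz (n (nth v0 L r) (nth v0 L t)) = (- nth 0 (nth [::] M r) t)%R].

(* A Cartan matrix, then [kap] and [x / l] along its numbering. *)
Definition family_table : seq (seq (seq int) * seq nat * seq nat) :=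
  [:: (cartan_A5, [:: 1; 3; 1; 3; 1], [:: 1; 1; 2; 1; 1]);
      (cartan_A5, [:: 3; 1; 3; 1; 3], [:: 1; 3; 2; 3; 1]);
      (cartan_B3, [:: 1; 3; 1], [:: 1; 1; 2]);
      (cartan_B3, [:: 3; 1; 3], [:: 1; 3; 2]);
      (cartan_C3, [:: 1; 3; 1], [:: 1; 1; 1]);
      (cartan_C3, [:: 3; 1; 3], [:: 1; 3; 1]);
      (cartan_D4, [:: 1; 3; 1; 1], [:: 1; 1; 1; 1]);
      (cartan_D4, [:: 3; 1; 3; 3], [:: 1; 3; 1; 1]);
      (cartan_G2, [:: 3; 1], [:: 1; 1]);
      (cartan_G2, [:: 1; 3], [:: 3; 1])].

Definition in_family M K X := exists L l,
  [/\ realizes M L, 0 < l, map kap L = K & map x L = map (muln l) X].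

Definition classified := exists2 t, t \in family_table & in_family t.1.1 t.1.2 t.2.

(** [L0] is the order in which the nodes were discovered and [L] the order of the family's
    numbering, which may differ; [use_family] discharges the remaining premises by computation and
    linear arithmetic. *)
Lemma classified_intro L0 L l M K X : (M, K, X) \in family_table ->
  uniq L0 -> L0 =i predT -> perm_eq L L0 -> 0 < l -> size L = size M ->
  map kap L = K -> map x L = map (muln l) X ->
  (forall v0 r t, r < size M -> t < size M -> r != t ->
      Posz (n (nth v0 L r) (nth v0 L t)) = (- nth 0 (nth [::] M r) t)%R) ->
  classified.
Proof.
move=> ? uq full pL ? ? ? ? ?; exists (M, K, X) => //; exists L, l.
by split=> //; split=> //; [rewrite (perm_uniq pL)|move=> u; rewrite (perm_mem pL)].
Qed.

Ltac use_family uq full L l M K X :=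
  apply: (@classified_intro _ L l M K X _ uq full);
  [ by vm_compute
  | by apply/permP=> ? /=; clear; lia
  | lia
  | by []
  | rewrite /=; repeat (congr cons); lia
  | rewrite /=; repeat (congr cons); lia
  | let r := fresh in let t := fresh in
    move=> ? [|[|[|[|[|r]]]]] [|[|[|[|[|t]]]]] //= _ _ _;
    match goal with E : n ?u ?v = _ |- context [n ?u ?v] => by rewrite E end].

(** The orientation of the double edge separates B3 from C3, and the value of [kap] at the centre
    separates the two families of each type. The scale [l] is the value of [x] at a node where the
    family has ratio 1. *)
Lemma star3_classified v u1 u2 :
  uniq [:: v; u1; u2] -> [:: v; u1; u2] =i predT ->
  n v u1 * n u1 v = 1 -> n v u2 * n u2 v = 2 -> n u1 u2 = 0 -> n u2 u1 = 0 ->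
  kap u1 * kap v = 3 -> kap u2 * kap v = 3 ->
  kap u1 * x u1 = n u1 v * x v -> kap u2 * x u2 = n u2 v * x v ->
  kap v * x v = n v u1 * x u1 + n v u2 * x u2 -> classified.
Proof.
move=> uq full /mul_eq1[n1 m1] /mul_eq2 n2 z1 z2 k1 k2 x1 x2 xv.
have xv0 := x_gt0 v; rewrite m1 in x1; rewrite n1 in xv.
case: n2 => -[n2 m2]; rewrite m2 in x2; rewrite n2 in xv;
  have [[l1 l2]|[l1 l2]] := mul_eq3 k1; rewrite l1 in x1; rewrite l2 in xv k2;
  have l3 : kap u2 = kap u1 by [lia]; rewrite l3 l1 in x2.
- by use_family uq full [:: u1; v; u2] (x u1) cartan_C3 [:: 3; 1; 3] [:: 1; 3; 1].
- by use_family uq full [:: u1; v; u2] (x v) cartan_C3 [:: 1; 3; 1] [:: 1; 1; 1].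
- by use_family uq full [:: u1; v; u2] (x u1) cartan_B3 [:: 3; 1; 3] [:: 1; 3; 2].
- by use_family uq full [:: u1; v; u2] (x v) cartan_B3 [:: 1; 3; 1] [:: 1; 1; 2].
Qed.

(** By [weight_eq3] every neighbour is a leaf, so the star is the whole diagram. The weight 3 is
    spread over the edges as 3 (G2), 1 + 2 (B3 or C3) or 1 + 1 + 1 (D4); four edges would weigh at
    least 4. *)
Lemma star_classified v :
  \sum_(u <- nbrs v) n v u * n u v = 3 -> classified.
Proof.
move=> w3; have leaf u := weight_eq3 (u := u) w3.
have full : v :: nbrs v =i predT.
  apply: full_seq => // u; rewrite inE => /predU1P[-> t tv|/leaf-> t].
    by rewrite inE tv orbT.
  by rewrite inE => /eqP->; exact: mem_head.
have uq : uniq (v :: nbrs v) by rewrite /= nbrs_uniq mem_nbrs n_diag.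
have leafP u : u \in nbrs v ->
    [/\ 0 < n u v, 0 < n v u, kap u * x u = n u v * x v, 0 < x u
      & forall t, t != v -> n u t = 0].
  move=> uv; split=> //.
  - by rewrite -mem_nbrs -nbrs_sym.
  - by rewrite -mem_nbrs.
  - by rewrite x_nbrs leaf // big_seq1.
  - by move=> t tv; apply: nbrs_n0; rewrite leaf // inE.
have xv0 := x_gt0 v; have xv := x_nbrs v.
have nbr_kap u (uv : u \in nbrs v) := kap_cases uv.
case E: (nbrs v) full uq w3 leafP xv nbr_kap => [|u1 [|u2 [|u3 [|u4 s]]]] full uq;
  rewrite ?big_cons ?big_nil ?addn0 => w3 leafP xv nbr_kap.
- by [].
- have [|p1 q1 x1 x10 z1] := leafP u1; first by rewrite inE eqxx.
  have [[n1 n2]|[n1 n2]] := mul_eq3 w3; rewrite n1 in xv; rewrite n2 in x1.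
  + have [[k1 k2]|[k1 k2]] := nbr_kap u1 (mem_head _ _); rewrite k1 in xv; rewrite k2 in x1.
    * use_family uq full [:: v; u1] (x u1) cartan_G2 [:: 3; 1] [:: 1; 1].
    * use_family uq full [:: v; u1] (x u1) cartan_G2 [:: 1; 3] [:: 3; 1].
  + have [[k1 k2]|[k1 k2]] := nbr_kap u1 (mem_head _ _); rewrite k1 in xv; rewrite k2 in x1.
    * use_family uq full [:: u1; v] (x v) cartan_G2 [:: 1; 3] [:: 3; 1].
    * use_family uq full [:: u1; v] (x v) cartan_G2 [:: 3; 1] [:: 1; 1].
- have [|p1 q1 x1 x10 z1] := leafP u1; first by rewrite !inE eqxx.
  have [|p2 q2 x2 x20 z2] := leafP u2; first by rewrite !inE eqxx orbT.
  have [k1 k2] : kap u1 * kap v = 3 /\ kap u2 * kap v = 3 by rewrite !kap_adj.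
  have [u1v u2v] : u1 != v /\ u2 != v.
    by move: uq; rewrite /= !inE negb_or ![_ == v]eq_sym => /andP[/andP[-> ->]].
  have n12 := z1 _ u2v; have n21 := z2 _ u1v.
  have m1 : 0 < n v u1 * n u1 v by rewrite muln_gt0 q1.
  have m2 : 0 < n v u2 * n u2 v by rewrite muln_gt0 q2.
  have [l1|l1] : n v u1 * n u1 v = 1 \/ n v u1 * n u1 v = 2 by lia.
    by apply: (@star3_classified v u1 u2) => //; lia.
  apply: (@star3_classified v u2 u1) => //; try lia.
    by apply: etrans uq; apply: perm_uniq; apply/permP => ? /=; lia.
  by move=> t; rewrite -full !inE; congr orb; rewrite orbC.
- have [|p1 q1 x1 x10 z1] := leafP u1; first by rewrite !inE eqxx.
  have [|p2 q2 x2 x20 z2] := leafP u2; first by rewrite !inE eqxx orbT.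
  have [|p3 q3 x3 x30 z3] := leafP u3; first by rewrite !inE eqxx !orbT.
  have [k1 [k2 k3]] : kap u1 * kap v = 3 /\ kap u2 * kap v = 3 /\ kap u3 * kap v = 3.
    by rewrite !kap_adj.
  have [u1v [u2v u3v]] : u1 != v /\ u2 != v /\ u3 != v.
    by move: uq; rewrite /= !inE !negb_or ![_ == v]eq_sym => /andP[/and3P[-> -> ->]].
  have n12 := z1 _ u2v; have n21 := z2 _ u1v; have n13 := z1 _ u3v.
  have n31 := z3 _ u1v; have n23 := z2 _ u3v; have n32 := z3 _ u2v.
  have m1 : 0 < n v u1 * n u1 v by rewrite muln_gt0 q1.
  have m2 : 0 < n v u2 * n u2 v by rewrite muln_gt0 q2.
  have m3 : 0 < n v u3 * n u3 v by rewrite muln_gt0 q3.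
  have /mul_eq1[r1 s1] : n v u1 * n u1 v = 1 by lia.
  have /mul_eq1[r2 s2] : n v u2 * n u2 v = 1 by lia.
  have /mul_eq1[r3 s3] : n v u3 * n u3 v = 1 by lia.
  rewrite s1 in x1; rewrite s2 in x2; rewrite s3 in x3; rewrite r1 r2 r3 in xv.
  have [[l1 l2]|[l1 l2]] := mul_eq3 k1; rewrite l1 in x1; rewrite l2 in xv k2 k3;
    have l3 : kap u2 = kap u1 by [lia]; have l4 : kap u3 = kap u1 by [lia];
    rewrite l3 l1 in x2; rewrite l4 l1 in x3.
  + by use_family uq full [:: u1; v; u2; u3] (x u1) cartan_D4 [:: 3; 1; 3; 3] [:: 1; 3; 1; 1].
  + by use_family uq full [:: u1; v; u2; u3] (x v) cartan_D4 [:: 1; 3; 1; 1] [:: 1; 1; 1; 1].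
- have [|p1 q1 _ _ _] := leafP u1; first by rewrite !inE eqxx.
  have [|p2 q2 _ _ _] := leafP u2; first by rewrite !inE eqxx orbT.
  have [|p3 q3 _ _ _] := leafP u3; first by rewrite !inE eqxx !orbT.
  have [|p4 q4 _ _ _] := leafP u4; first by rewrite !inE eqxx !orbT.
  have m1 : 0 < n v u1 * n u1 v by rewrite muln_gt0 q1.
  have m2 : 0 < n v u2 * n u2 v by rewrite muln_gt0 q2.
  have m3 : 0 < n v u3 * n u3 v by rewrite muln_gt0 q3.
  have m4 : 0 < n v u4 * n u4 v by rewrite muln_gt0 q4.
  by move: w3; lia.
Qed.

(** * Simply laced paths: all weights at most 2 *)

Section WeightAtMost2.
Hypothesis w_le2 : forall v, \sum_(u <- nbrs v) n v u * n u v <= 2.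

(** An edge with [n v u * n u v = 2] would exhaust the weight of both its ends, so each end would
    have no other neighbour. Then [kap v * x v = n v u * x u] and [kap u * x u = n u v * x v], whose
    product reads 3 = 2. *)
Lemma simply_laced v u : u \in nbrs v -> n v u = 1.
Proof.
move=> uv; have pos a b : b \in nbrs a -> 0 < n a b * n b a.
  by rewrite muln_gt0 [0 < n b a]n_sym_gt0 -mem_nbrs andbb.
have single a b : b \in nbrs a -> n a b * n b a = 2 -> kap a * x a = n a b * x b.
  move=> ba nab; have := w_le2 a; rewrite x_nbrs.
  rewrite !(perm_big _ (perm_to_rem ba)) !big_cons nab /=.
  case E: (rem b (nbrs a)) => [|c s]; first by rewrite !big_nil !addn0.
  have /pos : c \in nbrs a by apply: (mem_rem (x := b)); rewrite E mem_head.
  by rewrite big_cons; lia.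
have := w_le2 v; rewrite (perm_big _ (perm_to_rem uv)) big_cons /=.
have := pos _ _ uv => p1 p2.
have [/mul_eq1[] //|n2] : n v u * n u v = 1 \/ n v u * n u v = 2 by lia.
have x1 := single _ _ uv n2; have x2 : kap u * x u = n u v * x v.
  by apply: single; [rewrite nbrs_sym|rewrite mulnC].
have : kap u * kap v = 3 by rewrite kap_adj // n_sym_gt0 -mem_nbrs.
by have := x_gt0 v; nia.
Qed.

(** With simple edges the weight is the degree, so a walk that enters [v] from [u] either ends there
    or has exactly one way on. *)
Lemma nbrs_walk v u : u \in nbrs v ->
  (nbrs v =i [:: u] /\ kap v * x v = x u) \/
  exists w, [/\ w != u, nbrs v =i [:: u; w] & kap v * x v = x u + x w].
Proof.
move=> uv; have sumE (F : I -> nat) : \sum_(t <- nbrs v) n v t * F t = \sum_(t <- nbrs v) F t.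
  by rewrite !big_seq; apply: eq_bigr => t tv; rewrite simply_laced // mul1n.
have := w_le2 v; rewrite x_nbrs !sumE.
have -> : \sum_(t <- nbrs v) n t v = \sum_(t <- nbrs v) 1.
  by rewrite !big_seq; apply: eq_bigr => t tv; rewrite simply_laced // nbrs_sym.
rewrite sum1_size (perm_size (perm_to_rem uv)) (perm_big _ (perm_to_rem uv)) big_cons.
have memE := perm_mem (perm_to_rem uv); have := nbrs_uniq v.
rewrite (perm_uniq (perm_to_rem uv)); move: memE.
case: (rem u (nbrs v)) => [|w [|//]] memE /=.
  by left; rewrite big_nil addn0.
by rewrite inE eq_sym => /andP[wu _] _; right; exists w; rewrite big_seq1.
Qed.

(** Take [v] minimising [x] among the nodes with the same [kap] as [v0]. If [v] and its neighbours
    [u], [w] all had degree two, the nodes two steps away would be at least [x v], so [kap u * x u]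
    and [kap w * x w] would both be at least [2 * x v]; their sum is [3 * x v], a contradiction. *)
Lemma exists_leaf (v0 : I) : exists v u, nbrs v =i [:: u] /\ kap v * x v = x u.
Proof.
pose P u := kap u == kap v0; have Pv0 : P v0 by rewrite /P.
case: (arg_minnP x Pv0) => v /eqP Pv xmin.
case E: (nbrs v) (nbrs_neq0 v) => [//|u s] _.
have uv : u \in nbrs v by rewrite E mem_head.
have vu : v \in nbrs u by rewrite nbrs_sym.
have [|[w [wu nv xv]]] := nbrs_walk uv; first by exists v, u.
have wv : w \in nbrs v by rewrite nv !inE eqxx orbT.
have vw : v \in nbrs w by rewrite nbrs_sym.
have far c : c \in nbrs v -> forall t, t \in nbrs c -> x v <= x t.
  move=> cv t tc; apply: xmin; apply/eqP; rewrite -Pv.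
  by have := kap_cases cv; have := kap_cases tc; lia.
have [|[t [_ nu xu]]] := nbrs_walk vu; first by exists u, v.
have [|[r [_ nw xw]]] := nbrs_walk vw; first by exists w, v.
have xt : x v <= x t by apply: (far u uv); rewrite nu !inE eqxx orbT.
have xr : x v <= x r by apply: (far w wv); rewrite nw !inE eqxx orbT.
by have := x_gt0 v; have := kap_cases uv; have := kap_cases wv; nia.
Qed.

(** Put [k = kap v1] at a leaf [v1]. Solving [x_eq] along the walk gives the ratios 1, k, 2, k, 1 to
    [x v1]. Stopping before the fifth node contradicts [x_eq] there, and a sixth node would get the
    value 0. *)
Lemma path_classified (v0 : I) : classified.
Proof.
have [v1 [v2 [N1 x1]]] := exists_leaf v0.
have v21 : v2 \in nbrs v1 by rewrite N1 mem_head.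
have v12 : v1 \in nbrs v2 by rewrite nbrs_sym.
have xv1 := x_gt0 v1; have k12 := kap_cases v21.
have [[_ ?]|[v3 [v31 N2 x2]]] := nbrs_walk v12; first by nia.
have v32 : v3 \in nbrs v2 by rewrite N2 !inE eqxx orbT.
have v23 : v2 \in nbrs v3 by rewrite nbrs_sym.
have k23 := kap_cases v32.
have [[_ ?]|[v4 [v42 N3 x3]]] := nbrs_walk v23; first by nia.
have v43 : v4 \in nbrs v3 by rewrite N3 !inE eqxx orbT.
have v34 : v3 \in nbrs v4 by rewrite nbrs_sym.
have k34 := kap_cases v43.
have [[_ ?]|[v5 [v53 N4 x4]]] := nbrs_walk v34; first by nia.
have v54 : v5 \in nbrs v4 by rewrite N4 !inE eqxx orbT.
have v45 : v4 \in nbrs v5 by rewrite nbrs_sym.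
have k45 := kap_cases v54.
have [[N5 x5]|[v6 [_ _ x5]]] := nbrs_walk v45; last first.
  by have xv6 := x_gt0 v6; clear -k12 k23 k34 k45 x1 x2 x3 x4 x5 xv6; nia.
have kapE : [/\ kap v3 = kap v1, kap v5 = kap v1, kap v4 = kap v2 & kap v2 <> kap v1].
  by clear -k12 k23 k34 k45; split; lia.
case: kapE => k3 k5 k4 k2.
have far a b : kap a <> kap b -> a != b by apply: contra_not_neq => ->.
(* These two nodes have equal [kap], so parity does not separate them; but [v4] is adjacent to [v5],
   while the only neighbour of [v1] is [v2]. *)
have v51 : v5 != v1.
  by apply: contraNneq v42 => v51; move: v45; rewrite v51 N1 inE.
have uq : uniq [:: v1; v2; v3; v4; v5].
  rewrite /= !inE !negb_or ![v1 == _]eq_sym ![v2 == _]eq_sym [v3 == v5]eq_sym.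
  by rewrite v31 v51 v42 v53 !far //; congruence.
have full : [:: v1; v2; v3; v4; v5] =i predT.
  apply: full_seq => // u; rewrite [u \in _]inE => /predU1P[->|].
    by move=> t; rewrite N1 !inE => /eqP->; rewrite eqxx ?orbT.
  rewrite inE => /predU1P[->|].
    by move=> t; rewrite N2 !inE => /pred2P[]->; rewrite eqxx ?orbT.
  rewrite inE => /predU1P[->|].
    by move=> t; rewrite N3 !inE => /pred2P[]->; rewrite eqxx ?orbT.
  rewrite inE => /predU1P[->|].
    by move=> t; rewrite N4 !inE => /pred2P[]->; rewrite eqxx ?orbT.
  by rewrite inE => /eqP-> t; rewrite N5 !inE => /eqP->; rewrite eqxx ?orbT.
have same a b : kap a = kap b -> n a b = 0.
  case: (posnP (n a b)) => // /kap_adj kab kabE; rewrite kabE in kab.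
  by clear -kab; case: (kap b) kab => [|[|k]]; nia.
have n12 := simply_laced v21; have n21 := simply_laced v12.
have n23 := simply_laced v32; have n32 := simply_laced v23.
have n34 := simply_laced v43; have n43 := simply_laced v34.
have n45 := simply_laced v54; have n54 := simply_laced v45.
have n13 : n v1 v3 = 0 by apply: same.
have n15 : n v1 v5 = 0 by apply: same.
have n35 : n v3 v5 = 0 by apply: same; congruence.
have n24 : n v2 v4 = 0 by apply: same.
have n14 : n v1 v4 = 0 by apply: nbrs_n0; rewrite N1 inE.
have n25 : n v2 v5 = 0 by apply: nbrs_n0; rewrite N2 !inE negb_or v51.
have n31 := n_sym0 n13; have n51 := n_sym0 n15; have n53 := n_sym0 n35.
have n42 := n_sym0 n24; have n41 := n_sym0 n14; have n52 := n_sym0 n25.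
rewrite k3 in x3; rewrite k4 in x4; rewrite k5 in x5.
case: k12 => -[l1 l2]; rewrite l1 in x1 x3 x5; rewrite l2 in x2 x4;
  rewrite l1 in k3 k5; rewrite l2 in k4;
  clear -uq full xv1 x1 x2 x3 x4 x5 l1 l2 k3 k4 k5 n12 n21 n13 n31 n14 n41 n15 n51
         n23 n32 n24 n42 n25 n52 n34 n43 n35 n53 n45 n54.
- by use_family uq full [:: v1; v2; v3; v4; v5] (x v1) cartan_A5
       [:: 3; 1; 3; 1; 3] [:: 1; 3; 2; 3; 1].
- by use_family uq full [:: v1; v2; v3; v4; v5] (x v1) cartan_A5
       [:: 1; 3; 1; 3; 1] [:: 1; 1; 2; 1; 1].
Qed.
End WeightAtMost2.

Lemma classification (v0 : I) : classified.
Proof.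
have [[v w3]|w_le2] : (exists v, \sum_(u <- nbrs v) n v u * n u v = 3)
    \/ forall v, \sum_(u <- nbrs v) n v u * n u v <= 2.
- have [/existsP[v /eqP w3]|/existsPn w3] :=
    boolP [exists v, \sum_(u <- nbrs v) n v u * n u v == 3]; first by left; exists v.
  by right=> v; have := weight_le3 v; have := w3 v; lia.
- exact: star_classified w3.
- exact: path_classified.
Qed.
End DoubledEigenvector.

Local Open Scope ring_scope.

(** * Commuting divided powers *)

Lemma prod_perm_comm (R : pzSemiRingType) (T : eqType) (F : T -> R) (r1 r2 : seq T) :
  (forall u v, u \in r1 -> v \in r1 -> GRing.comm (F u) (F v)) ->
  perm_eq r1 r2 -> \prod_(u <- r1) F u = \prod_(u <- r2) F u.
Proof.
elim: r1 r2 => [|u r1 IH] r2 Fcomm; first by rewrite perm_sym => /perm_nilP->.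
move=> p12; have ur2 : u \in r2 by rewrite -(perm_mem p12) mem_head.
have Fr2 v : v \in r2 -> GRing.comm (F u) (F v).
  by rewrite -(perm_mem p12) => vr; apply: Fcomm => //; exact: mem_head.
case/splitPr: ur2 p12 Fr2 => p1 p2 p12 Fr2.
rewrite big_cons (IH (p1 ++ p2)) => [|v w vr wr|]; last 2 first.
- by apply: Fcomm; rewrite inE ?vr ?wr orbT.
- rewrite -(perm_cons u) (perm_trans p12) //.
  by apply/permP=> a; rewrite /= !count_cat /= addnCA.
rewrite !big_cat big_cons /= !mulrA; congr (_ * _).
rewrite big_seq; apply: commr_prod => v vp1.
by apply: Fr2; rewrite mem_cat vp1.
Qed.

Lemma scale_comm (R : comPzRingType) (A : algType R) (a b : R) (x y : A) :
  GRing.comm x y -> GRing.comm (a *: x) (b *: y).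
Proof.
rewrite /GRing.comm => xy; rewrite -!scalerAl -!scalerAr !scalerA xy.
by rewrite [a * b]mulrC.
Qed.

Lemma qvar_expn_neq1 n : (0 < n)%N -> qvar ^+ n != 1.
Proof.
move=> n0; rewrite /qvar -rmorphXn -(rmorph1 (@tofrac _)) tofrac_eq.
by apply/eqP=> /(congr1 (fun p : {poly rat} => size p)); rewrite size_polyXn size_poly1; case: n n0.
Qed.

Lemma qvar_neq0 : qvar != 0.
Proof. by rewrite /qvar tofrac_eq0 polyX_eq0. Qed.

(** Numerator and denominator agree; the point is that the denominator is nonzero, because [qvar] is
    not a root of unity. *)
Lemma qnum1 d : (0 < d)%N -> qnum d 1 = 1.
Proof.
move=> d0; rewrite /qnum !expr1 divff // subr_eq0.
apply/eqP=> /(congr1 ( *%R (qvar ^+ d))).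
rewrite mulfV ?expf_neq0 ?qvar_neq0 // -exprD; apply/eqP.
by rewrite qvar_expn_neq1 // addn_gt0 d0.
Qed.

Section DividedPowers.
Variables (K : nzRingType) (I : finType) (c : I -> I -> K) (d : I -> nat).

(** For [c i j = 0] the Serre relation has [n = 1] and is a commutator up to sign, which makes
    generators at orthogonal nodes commute. *)
Lemma serre_rel1 i j : (0 < d i)%N ->
  serre_rel d i j 1 = letter j * letter i - letter i * letter j.
Proof.
move=> di; rewrite /serre_rel big_ord_recl big_ord1 /= /free_dpow /qfact.
rewrite big_nat1 big_geq // qnum1 // invr1 !scale1r.
by rewrite subn0 /bump /= !expr1 !expr0 mul1r mulr1 scaleN1r.
Qed.

Lemma gen_comm i j : (0 < d i)%N -> i != j -> c i j = 0 ->
  GRing.comm (gen c d i) (gen c d j).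
Proof.
move=> di ij cij; have E : \pi_(Uqm c d)%qT (letter j * letter i)
    = \pi_(Uqm c d)%qT (letter i * letter j).
  by apply/Uqm_eqP; rewrite -serre_rel1 //; apply: SerreRel => //; rewrite cij subr0.
have E1 := Defs.pi_mul c d (letter j) (letter i).
have E2 := Defs.pi_mul c d (letter i) (letter j).
exact: (etrans (esym E2) (etrans (esym E) E1)).
Qed.

Lemma dpow_comm i j k l : (0 < d i)%N -> i != j -> c i j = 0 ->
  GRing.comm (dpow c d i k) (dpow c d j l).
Proof.
move=> di ij cij; apply: scale_comm.
by apply/commrX/commr_sym/commrX/commr_sym/gen_comm.
Qed.

(** Indexing by a list of nodes, with exponents attached to the nodes, frees the product from the
    enumeration by ['I_p] and lets a family's own order be used. *)
Definition dprod (y : I -> nat) (r : seq I) : Uqm c d := \prod_(u <- r) dpow c d u (y u).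

Lemma dmonoE p (i : 'I_p -> I) a y r : injective i -> (forall k, a k = y (i k)) ->
  (forall u, (0 < d u)%N) -> (forall k l, k != l -> c (i k) (i l) = 0) ->
  uniq r -> (forall u, (u \in r) = (u \in codom i)) ->
  dmono c d i a = dprod y r.
Proof.
move=> i_inj ay d_gt0 c0 r_uniq r_mem; rewrite /dmono /dprod.
transitivity (\prod_(u <- codom i) dpow c d u (y u)).
  by rewrite /codom /image_mem big_map enumT; apply: eq_bigr => k _; rewrite ay.
apply: prod_perm_comm.
  move=> _ _ /codomP[k ->] /codomP[l ->].
  have [->|kl] := eqVneq k l; first exact: commr_refl.
  by apply: dpow_comm; rewrite ?(inj_eq i_inj) ?c0.
by rewrite perm_sym; apply: uniq_perm => //; rewrite map_inj_uniq ?enum_uniq.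
Qed.
End DividedPowers.

(** * Weights and root spaces *)

(** Applying [T - lam k0] to the relation kills the first term and multiplies the others by nonzero
    scalars, so induction on the list applies. *)
Lemma eigenvectors_indep (K : fieldType) (V : lmodType K) (T : {linear V -> V})
    (J : eqType) (r : seq J) (lam : J -> K) (y : J -> V) :
  uniq r -> {in r &, injective lam} -> (forall k, k \in r -> T (y k) = lam k *: y k) ->
  \sum_(k <- r) y k = 0 -> forall k, k \in r -> y k = 0.
Proof.
elim: r y => [//|k0 r IH] y /= /andP[k0r r_uniq] lam_inj Ty.
rewrite big_cons => y_sum.
have in_r k : k \in r -> k \in k0 :: r by rewrite inE orbC => ->.
have y0 k : k \in r -> y k = 0.
  move=> kr; suff: (lam k - lam k0) *: y k = 0.
    move/eqP; rewrite scaler_eq0 subr_eq0 => /orP[/eqP lamE|/eqP//].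
    have kk0 : k = k0 by apply: lam_inj lamE; rewrite ?mem_head ?in_r.
    by rewrite -kk0 kr in k0r.
  move: k kr; apply: (IH (fun k => (lam k - lam k0) *: y k)) => //.
  - by move=> k l kr lr; apply: lam_inj; apply: in_r.
  - by move=> k kr; rewrite linearZ /= Ty ?in_r // !scalerA mulrC.
  transitivity (\sum_(k <- r) (T (y k) - lam k0 *: y k)).
    by rewrite !big_seq; apply: eq_bigr => k kr; rewrite Ty ?in_r // scalerBl.
  rewrite sumrB -linear_sum -scaler_sumr.
  have -> : \sum_(k <- r) y k = - y k0 by apply/eqP; rewrite -addr_eq0 addrC y_sum.
  by rewrite linearN Ty ?mem_head // scalerN subrr.
move=> k; rewrite inE => /predU1P[->|/y0//].
by move: y_sum; rewrite big_seq big1 ?addr0.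
Qed.

(** Otherwise the first [\dim {:V} + 1] terms would be linearly independent. *)
Lemma eigenvector_seq_vanishes (K : fieldType) (V : vectType K) (T : {linear V -> V})
    (lam : nat -> K) (y : nat -> V) :
  injective lam -> (forall k, T (y k) = lam k *: y k) -> exists k, y k = 0.
Proof.
move=> lam_inj Ty; apply: contrapT => /forallNP y_neq0.
pose m := (\dim {:V}).+1.
have : free [tuple y k | k < m].
  apply/freeP=> a a0 k.
  have /(_ k) : forall k, k \in enum 'I_m -> a k *: y k = 0.
    apply: (@eigenvectors_indep _ _ T _ _ (fun k : 'I_m => lam k) _ (enum_uniq _)).
    - by move=> u v _ _ /lam_inj/val_inj.
    - by move=> u _; rewrite linearZ /= Ty !scalerA mulrC.
    rewrite -[RHS]a0 big_enum; apply: eq_bigr => u _.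
    by rewrite -tnth_nth tnth_mktuple.
  rewrite mem_enum => /(_ isT)/eqP; rewrite scaler_eq0 => /orP[/eqP//|/eqP /y_neq0//].
move=> /eqP/esym; rewrite size_tuple; have := dimvS (subvf <<[tuple y k | k < m]>>%VS).
by move=> le_dim dimE; rewrite -dimE ltnn in le_dim.
Qed.

(** * Lowest weights in representations of sl2 *)

Section SL2.
Variables (K : numFieldType) (V : vectType K) (e f hh : {linear V -> V}).
Hypotheses (ef : forall x, e (f x) - f (e x) = hh x)
           (he : forall x, hh (e x) = e (hh x) + 2%:R *: e x).
Variables (x : V) (lam : K).
Hypotheses (x_neq0 : x != 0) (hx : hh x = lam *: x) (efx : e (f x) = 0).

Let ek k := iter k e x.

Lemma sl2_iter_weight k : hh (ek k) = (lam + (2 * k)%:R) *: ek k.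
Proof.
elim: k => [|k IH]; first by rewrite muln0 addr0 hx.
by rewrite /ek /= -/(ek k) he IH linearZ /= -scalerDl -addrA -natrD mulnSr.
Qed.

Lemma sl2_iter_lower k :
  f (ek k.+1) = - (k.+1%:R * (lam + k%:R)) *: ek k.
Proof.
have fe z : f (e z) = e (f z) - hh z by rewrite -ef subKr.
elim: k => [|k IH]; first by rewrite fe efx sub0r hx mul1r addr0 scaleNr.
have ekS l : ek l.+1 = e (ek l) by [].
rewrite ekS fe IH linearZZ -ekS sl2_iter_weight -scalerBl.
congr (_ *: _); rewrite -opprD; congr (- _).
by rewrite natrM -!natr1; ring.
Qed.

(* The hypothesis [e (f x) = 0], weaker than [f x = 0], already gives the usual
   formula for [f] on the ladder [e^k x]. *)
Lemma sl2_lowest_weight : exists n, lam = - n%:R.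
Proof.
have [||k ek0] := @eigenvector_seq_vanishes _ _ hh (fun k => lam + (2 * k)%:R) ek.
- by move=> k l /addrI/eqP; rewrite eqr_nat eqn_pmul2l // => /eqP.
- exact: sl2_iter_weight.
(* Descend from a vanishing term of the ladder: if [ek k.+1 = 0], then either [lam = - k%:R] or
   [ek k = 0] already, and [ek 0 = x] is nonzero. *)
elim: k ek0 => [/eqP|k IH ek0]; first by rewrite (negPf x_neq0).
have := sl2_iter_lower k; rewrite ek0 linear0 => /esym/eqP.
rewrite scaler_eq0 oppr_eq0 mulf_eq0 pnatr_eq0 /= => /orP[|/eqP/IH//].
by rewrite addr_eq0 => /eqP ->; exists k.
Qed.
End SL2.

Section LieBasics.
Variables (K : fieldType) (g : lieAlgType K).
Implicit Types x y z : g.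

HB.instance Definition _ x :=
  GRing.isLinear.Build K g g *:%R (bracket x) (bracket_linearr x).

Lemma bracketDl x y z : bracket (x + y) z = bracket x z + bracket y z.
Proof. by have := bracket_linearl z 1 x y; rewrite /= !scale1r. Qed.

Lemma bracket0l z : bracket 0 z = 0.
Proof. by apply: (addIr (bracket 0 z)); rewrite -bracketDl !add0r. Qed.

Lemma bracketZl a x z : bracket (a *: x) z = a *: bracket x z.
Proof. by have := bracket_linearl z a x 0; rewrite /= !addr0 bracket0l addr0. Qed.

Lemma bracketC x y : bracket x y = - bracket y x.
Proof.
apply/eqP; rewrite -addr_eq0; have := bracket_alt (x + y).
by rewrite bracketDl !linearD /= !bracket_alt add0r addr0 => ->.
Qed.

Lemma bracket_deriv x y z :
  bracket x (bracket y z) = bracket (bracket x y) z + bracket y (bracket x z).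
Proof.
rewrite [bracket (bracket x y) z]bracketC [bracket x z]bracketC linearN -opprD.
by apply/eqP; rewrite -addr_eq0 [_ + bracket y _]addrC addrA bracket_jacobi.
Qed.
End LieBasics.

(** A subspace of maximal dimension among those contained in [P] works: adjoining any further vector
    of [P] stays inside [P], hence cannot raise the dimension. *)
Lemma prop_subspace (K : fieldType) (V : vectType K) (P : V -> Prop) :
  P 0 -> (forall a u v, P u -> P v -> P (a *: u + v)) ->
  exists U : {vspace V}, forall v, v \in U <-> P v.
Proof.
move=> P0 Plin; pose Q d := `[< exists2 U : {vspace V}, \dim U = d & forall v, v \in U -> P v >].
have Q0 : exists d, Q d.
  by exists 0; apply/asboolP; exists 0%VS; [rewrite dimv0|move=> v /[!memv0]/eqP->].
have Qmax d : Q d -> (d <= \dim {:V})%N.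
  by case/asboolP=> U <- _; apply/dimvS/subvf.
case: (ex_maxnP Q0 Qmax) => d /asboolP[U dU UP] dmax; exists U => v.
split=> [|Pv]; first exact: UP.
have /dmax : Q (\dim (<[v]> + U)%VS).
  apply/asboolP; exists (<[v]> + U)%VS => // _ /memv_addP[_ /vlineP[a ->] [u uU ->]].
  by apply: Plin => //; apply: UP.
rewrite -dU => le_dim.
have /eqP-> : U == (<[v]> + U)%VS by rewrite eqEdim addvSr.
by rewrite (subvP (addvSl <[v]> U)) ?memv_line.
Qed.

(** * Simultaneous diagonalisation by the Cartan subalgebra *)

Section WeightDecomposition.
Variables (K : fieldType) (g : lieAlgType K) (H : {vspace g}).
Hypothesis H_cartan : cartan_subalgebra H.
Implicit Types (x y z : g) (beta gamma : dual H).

Lemma cartan_abelian x y : x \in H -> y \in H -> bracket x y = 0.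
Proof. by case: H_cartan => ab _ _; apply: ab. Qed.

Lemma root_space_bracket beta gamma x y : root_space beta x -> root_space gamma y ->
  root_space (beta + gamma) (bracket x y).
Proof.
by move=> bx gy t; rewrite bracket_deriv bx gy linearZ bracketZl add_lfunE scalerDl.
Qed.

Lemma root_space0 x : root_space (0 : dual H) x <-> x \in H.
Proof.
case: H_cartan => ab self _; split=> [x0|xH t]; last first.
  by rewrite ab ?subvsP // zero_lfunE scale0r.
apply: self => y yH; have := x0 (Subvs yH).
by rewrite zero_lfunE scale0r.
Qed.

(** The coordinates of [x] in an eigenbasis are grouped by eigenvalue, so that the summands have
    distinct eigenvalues as [eigenvectors_indep] requires. *)
Lemma diagonal_decomposition t x : t \in H -> exists (r : seq K) (y : K -> g),
  [/\ uniq r, forall k, k \in r -> bracket t (y k) = k *: y k & x = \sum_(k <- r) y k].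
Proof.
case: H_cartan => _ _ diag /diag[X [bX]] eigX.
pose n := size X; pose Xt : n.-tuple g := in_tuple X.
have /choice[lam lamP] (i : 'I_n) : exists a, bracket t X`_i = a *: X`_i.
  by apply: eigX; rewrite mem_nth.
pose F i := coord Xt i x *: X`_i.
pose r := undup (codom lam).
exists r, (fun k => \sum_(i | lam i == k) F i); split; first exact: undup_uniq.
- move=> k _; rewrite linear_sum scaler_sumr; apply: eq_bigr => i /eqP <-.
  by rewrite linearZ /= lamP !scalerA mulrC.
rewrite {1}(coord_basis (X := Xt) bX (memvf x)).
under [RHS]eq_bigr do rewrite big_mkcond.
rewrite exchange_big /=; apply: eq_bigr => i _.
rewrite (bigD1_seq (lam i)) ?undup_uniq ?mem_undup ?codom_f //= eqxx big1 ?addr0 //.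
by move=> k; rewrite eq_sym => /negPf->.
Qed.

(** Elements are split along one [t] at a time. Since the elements of [H] commute, splitting a joint
    eigenvector of the others along [t] gives joint eigenvectors again. *)
Lemma simultaneous_ind (ts : seq g) x (Q : g -> Prop) :
  {subset ts <= H} -> Q 0 -> (forall y z, Q y -> Q z -> Q (y + z)) ->
  (forall z, (forall t, t \in ts -> exists a, bracket t z = a *: z) -> Q z) -> Q x.
Proof.
move=> + Q0 QD; elim: ts x => [|t ts IH] x tsH Qeig; first exact: Qeig.
apply: IH => [u uts|z z_eig]; first by apply: tsH; rewrite inE uts orbT.
have tH : t \in H by apply: tsH; rewrite mem_head.
have [r [y [r_uniq ty zE]]] := diagonal_decomposition z tH.
rewrite {}zE in z_eig *; rewrite big_seq; elim/big_ind: _ => // k kr.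
apply: Qeig => u; rewrite inE => /predU1P[->|uts]; first by exists k; apply: ty.
have [a ua] := z_eig u uts; exists a; apply/eqP; rewrite -subr_eq0; apply/eqP.
have uH : u \in H by apply: tsH; rewrite inE uts orbT.
(* The vectors [bracket u (y k) - a *: y k] are eigenvectors of [bracket t] for distinct eigenvalues
   and sum to [bracket u z - a *: z = 0], so each of them vanishes. *)
apply: (eigenvectors_indep (T := bracket t) (lam := id)
  (y := fun k => bracket u (y k) - a *: y k) r_uniq) => // [l lr|].
  rewrite linearB linearZ /= bracket_deriv (cartan_abelian tH uH) bracket0l add0r.
  by rewrite ty // linearZ scalerBr !scalerA mulrC.
by rewrite sumrB -linear_sum -scaler_sumr /= ua subrr.
Qed.

Lemma eigenvector_root_space x :
  (forall t, t \in vbasis H -> exists a, bracket t x = a *: x) ->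
  exists beta : dual H, root_space beta x.
Proof.
move=> x_eig; have [->|x_neq0] := eqVneq x 0.
  by exists 0 => t; rewrite linear0 scaler0.
(* The eigenvalue is the coordinate of [bracket t x] along [x]. It is read off from [bracket x t],
   whose linearity in [t] is at hand, and this reverses the sign. *)
pose phi : {linear subvs_of H -> K^o} := coord [tuple x] ord0 \o bracket x \o vsval.
exists (- linfun phi) => t; rewrite opp_lfunE lfunE /= scaleNr.
have [a tx] : exists a, bracket (vsval t) x = a *: x.
  rewrite (coord_vbasis (subvsP t)); elim/big_ind: _ => [|y z [a ya] [b zb]|i _].
  - by exists 0; rewrite bracket0l scale0r.
  - by exists (a + b); rewrite bracketDl ya zb scalerDl.
  have [|a ia] := x_eig (vbasis H)`_i; first by rewrite mem_nth ?size_tuple.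
  exists (coord (vbasis H) i (vsval t) * a).
  by rewrite bracketZl ia scalerA.
have x_free : free [tuple x] by rewrite seq1_free.
have coord_x : coord [tuple x] ord0 x = 1 := coord_free ord0 ord0 x_free.
have coord_ax : coord [tuple x] ord0 (a *: x) = a by rewrite linearZ /= coord_x mulr1.
by rewrite [bracket x _]bracketC tx linearN /= coord_ax scaleNr opprK.
Qed.

Lemma weight_ind (Q : g -> Prop) x :
  Q 0 -> (forall y z, Q y -> Q z -> Q (y + z)) ->
  (forall beta z, root_space beta z -> Q z) -> Q x.
Proof.
move=> Q0 QD Qroot; apply: (@simultaneous_ind (vbasis H)) => //.
  by move=> t; apply: vbasis_mem.
by move=> z /eigenvector_root_space[beta]; apply: Qroot.
Qed.

End WeightDecomposition.

(** * Connectedness of the diagram *)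

Section RootSystem.
Variables (K : numFieldType) (g : lieAlgType K) (H : {vspace g}) (I : finType).
Variables (alpha : I -> dual H) (h : I -> subvs_of H) (e f : I -> g).

Definition comb (u : I -> int) : dual H := \sum_i alpha i *~ u i.

Lemma combD u v : comb u + comb v = comb (fun i => u i + v i).
Proof. by rewrite /comb -big_split; apply: eq_bigr => i _; rewrite mulrzDr. Qed.

Lemma combN u : - comb u = comb (fun i => - u i).
Proof. by rewrite /comb -sumrN; apply: eq_bigr => i _; rewrite mulrNz. Qed.

Lemma comb_delta i : alpha i = comb (fun k => (k == i)%:Z).
Proof.
rewrite /comb (bigD1 i) //= eqxx big1 ?addr0 //.
by move=> k /negPf->; rewrite mulr0z.
Qed.

Definition independent := forall u : I -> K, \sum_i u i *: alpha i = 0 -> forall i, u i = 0.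

Lemma comb_inj u v : independent -> comb u = comb v -> u =1 v.
Proof.
move=> indep uv i; have /(_ i)/eqP : forall i, (u i - v i)%:~R = 0 :> K.
  apply: indep; transitivity (comb u - comb v); last by rewrite uv subrr.
  by rewrite combN combD; apply: eq_bigr => k _; rewrite scaler_int.
by rewrite intr_eq0 subr_eq0 => /eqP.
Qed.

Lemma comb0 : comb (fun=> 0) = 0.
Proof. by rewrite /comb big1. Qed.

(** These properties survive negating all simple roots and exchanging [e] with [f] ([root_datumN]),
    so statements about positive roots transfer to negative ones. *)
Definition root_datum :=
  [/\ independent,
      forall u, is_root (comb u) -> (forall i, 0 <= u i) \/ (forall i, u i <= 0),
      forall i, alpha i (h i) = 2%:R
    & forall i, [/\ root_space (alpha i) (e i), root_space (- alpha i) (f i)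
                  & vsval (h i) = bracket (e i) (f i)]].

Hypothesis datum : root_datum.

Lemma root_space_mixed_sign u x i j :
  root_space (comb u) x -> 0 < u i -> u j < 0 -> x = 0.
Proof.
case: datum => indep sgn _ _ ux ui uj; apply/eqP; apply: contraT => x_neq0.
have [|u_ge0|u_le0] := sgn u; last 2 first.
- by have := u_ge0 j; rewrite leNgt uj.
- by have := u_le0 i; rewrite leNgt ui.
split; last by exists x.
by apply/eqP; rewrite -comb0 => /(comb_inj indep)/(_ i) ui0; rewrite ui0 in ui.
Qed.

Lemma e_neq0 i : e i != 0.
Proof.
case: datum => _ _ ah /(_ i)[_ _ hE]; apply/eqP=> ei0.
have := ah i; have -> : h i = 0 by apply: val_inj; rewrite /= hE ei0 bracket0l.
by rewrite linear0 => /esym/eqP; rewrite pnatr_eq0.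
Qed.

Lemma root_lowest_weight beta i x : root_space beta x -> x != 0 ->
  bracket (e i) (bracket (f i) x) = 0 -> exists k, beta (h i) = - k%:R.
Proof.
case: datum => _ _ ah /(_ i)[ei fi hE] bx x_neq0 efx.
apply: (@sl2_lowest_weight K g (bracket (e i)) (bracket (f i)) (bracket (vsval (h i))) _ _ x) => //.
- by move=> y; rewrite /= bracket_deriv -hE addrK.
- by move=> y; rewrite /= bracket_deriv ei ah bracketZl addrC.
- exact: bx.
Qed.

(** The weight [alpha j - alpha i] has mixed signs, so [f i] kills [e j], which is thus a lowest
    weight vector for the sl2-triple of [i]. *)
Lemma cartan_int i j : i != j -> exists k, alpha j (h i) = - k%:R.
Proof.
case: datum => _ _ _ efh ij; have [ej _ _] := efh j; have [_ fi _] := efh i.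
apply: (root_lowest_weight (i := i) ej (e_neq0 j)).
suff -> : bracket (f i) (e j) = 0 by rewrite linear0.
have := root_space_bracket fi ej.
rewrite (comb_delta i) (comb_delta j) combN combD => fe.
by apply: (root_space_mixed_sign (i := j) (j := i) fe);
  rewrite eqxx ?[j == i]eq_sym (negPf ij).
Qed.

Section NoMixedRoot.
Variables (n : I -> I -> nat) (x : I -> nat) (S : {set I}).
Hypotheses (nE : forall i j, i != j -> alpha j (h i) = - (n i j)%:R)
  (x_gt0 : forall i, (0 < x i)%N)
  (x_sub : forall i, (\sum_(j | j != i) n i j * x j < 2 * x i)%N)
  (S_cut : forall i j, i \in S -> j \notin S -> n i j = 0%N).

(** At a node where the ratio [m i / x i] is largest, the strict inequality [x_sub] for [x] carries
    over to [m]. *)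
Lemma positive_coroot (m : I -> nat) i0 : (0 < m i0)%N ->
  exists2 i, (0 < m i)%N & (\sum_(j | j != i) n i j * m j < 2 * m i)%N.
Proof.
move=> mi0.
(* This is [m i / x i] multiplied by the product of all [x j], which keeps the ratios in the
   naturals. *)
have [i _ imax] := arg_maxnP (fun i => (m i * \prod_(j | j != i) x j)%N) (erefl : xpredT i0).
have {}imax j : (m j * x i <= m i * x j)%N.
  have [->//|ji] := eqVneq j i.
  have := imax j isT; pose y := (\prod_(k | (k != j) && (k != i)) x k)%N.
  have -> : (\prod_(k | k != j) x k = x i * y)%N by rewrite (bigD1 i) // eq_sym.
  have -> : (\prod_(k | k != i) x k = x j * y)%N.
    by rewrite (bigD1 j) //=; congr muln; apply: eq_bigl => k; rewrite andbC.
  by rewrite !mulnA /geq /= leq_pmul2r // prodn_gt0.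
exists i.
  by have := imax i0; have := x_gt0 i; have := x_gt0 i0; nia.
rewrite -(ltn_pmul2r (x_gt0 i)) big_distrl /=.
apply: (@leq_ltn_trans (\sum_(j | j != i) n i j * x j * m i)%N).
  by apply: leq_sum => j _; rewrite -!mulnA leq_mul2l [(x j * _)%N]mulnC imax orbT.
have mi : (0 < m i)%N by have := imax i0; have := x_gt0 i; have := x_gt0 i0; nia.
by rewrite -big_distrl /= mulnAC ltn_pmul2r.
Qed.

Lemma comb_coroot (m : I -> nat) i :
  comb (fun k => (m k)%:Z) (h i) = (2 * m i)%:R - (\sum_(j | j != i) n i j * m j)%:R.
Proof.
have scE j : (alpha j *~ (m j)%:Z) (h i) = (m j)%:R * alpha j (h i).
  by rewrite -pmulrn -scaler_nat scale_lfunE.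
rewrite sum_lfunE (bigD1 i) //= natr_sum -sumrN; congr (_ + _).
  by case: datum => _ _ ah _; rewrite scE ah mulrC natrM.
by apply: eq_bigr => j ji; rewrite scE nE 1?eq_sym // mulrN -natrM mulnC.
Qed.

(** Induction on the height. Some [i] in [S] pairs positively with the root, so [y = [f i, z]] is
    nonzero; by induction its weight lives outside [S], hence is orthogonal to [h i]. Then
    [[e i, y]] is a nonzero vector killed by [f i] of [h i]-weight 2, which sl2-theory forbids. *)
Lemma no_mixed_root (m : I -> nat) z i0 j0 :
  root_space (comb (fun k => (m k)%:Z)) z -> z != 0 ->
  i0 \in S -> (0 < m i0)%N -> j0 \notin S -> (0 < m j0)%N -> False.
Proof.
have [N] := ubnP (\sum_i m i); elim: N m z i0 => [//|N IH] m z i0 mN mz z_neq0 i0S mi0 j0S mj0.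
(* Only the part of [m] inside [S] is used, so that [i] lies in [S]; by [S_cut] the coefficients
   outside do not change the pairing with [h i]. *)
have [|i] := @positive_coroot (fun k => if k \in S then m k else 0%N) i0.
  by rewrite i0S.
case: ifP => // iS mi; have := iS.
have -> : (\sum_(j | j != i) n i j * (if j \in S then m j else 0)
    = \sum_(j | j != i) n i j * m j)%N.
  by apply: eq_bigr => j _; case: ifPn => // /(S_cut iS)->.
move=> _ pos; have [_ fi _] : [/\ root_space (alpha i) (e i), root_space (- alpha i) (f i)
    & vsval (h i) = bracket (e i) (f i)] by case: datum => _ _ _.
set y := bracket (f i) z; pose m1 k := (m k - (k == i))%N.
(* The truncated subtraction in [m1] is exact because [m i] is positive. *)
have m1E k : (m1 k)%:Z = - (k == i)%:Z + (m k)%:Z.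
  rewrite /m1; case: eqVneq => [->|_]; last by rewrite subn0 add0r.
  by rewrite -subzn // addrC.
have yw : root_space (comb (fun k => (m1 k)%:Z)) y.
  have := root_space_bracket fi mz; rewrite {1}comb_delta combN combD.
  by congr root_space; apply: eq_bigr => k _; rewrite m1E.
have pos_contra k w : (w < 2 * m i)%N -> (2 * m i)%:R - w%:R = - k%:R :> K -> False.
  move=> wm /eqP; rewrite subr_eq addrC eq_sym subr_eq -natrD eqr_nat.
  by move/eqP; lia.
have efz_neq0 : bracket (e i) y != 0.
  apply/eqP=> efz; have [k] := root_lowest_weight mz z_neq0 efz.
  by rewrite comb_coroot; apply: pos_contra.
have y_neq0 : y != 0 by apply: contraNneq efz_neq0 => ->; rewrite linear0.
have m1j0 : m1 j0 = m j0.
  by rewrite /m1; case: eqP => [j0i|]; rewrite ?subn0 //; rewrite j0i iS in j0S.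
have m1S k : k \in S -> m1 k = 0%N.
  move=> kS; apply/eqP; rewrite -leqn0 leqNgt; apply/negP => m1k.
  apply: (IH m1 y k) => //; last by rewrite m1j0.
  rewrite ltnS in mN; apply: leq_trans mN.
  rewrite (bigD1 i) //= [X in (_ < X)%N](bigD1 i) //=.
  have -> : (\sum_(l | l != i) m1 l = \sum_(l | l != i) m l)%N.
    by apply: eq_bigr => l /negPf li; rewrite /m1 li subn0.
  by rewrite /m1 eqxx; lia.
have y_wt : comb (fun k => (m1 k)%:Z) (h i) = 0.
  rewrite comb_coroot m1S // muln0 big1 ?subrr // => j _.
  by case: (boolP (j \in S)) => [/m1S->|/(S_cut iS)->]; rewrite ?muln0.
have fy0 : bracket (f i) y = 0.
  have := root_space_bracket fi yw; rewrite {1}comb_delta combN combD => fyw.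
  apply: (root_space_mixed_sign (i := j0) (j := i) fyw).
    by rewrite m1j0; case: eqVneq => [j0i|]; [rewrite j0i iS in j0S|rewrite oppr0 add0r].
  by rewrite m1S // eqxx addr0 ltrN10.
have [_ _ ah /(_ i)[ei _ hE]] := datum.
have fey0 : bracket (f i) (bracket (e i) y) = 0.
  have := bracket_deriv (e i) (f i) y.
  by rewrite fy0 linear0 -hE yw y_wt scale0r add0r => /esym.
have [|k] := root_lowest_weight (i := i) (root_space_bracket ei yw) efz_neq0.
  by rewrite fey0 linear0.
rewrite add_lfunE ah y_wt => /eqP.
by rewrite addr0 -addr_eq0 -natrD pnatr_eq0.
Qed.
End NoMixedRoot.
End RootSystem.

Lemma root_datumN (K : numFieldType) (g : lieAlgType K) (H : {vspace g}) (I : finType)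
    (alpha : I -> dual H) (h : I -> subvs_of H) (e f : I -> g) :
  root_datum alpha h e f -> root_datum (fun i => - alpha i) (fun i => - h i) f e.
Proof.
case=> indep sgn ah efh; have combE u : comb (fun i => - alpha i) u = comb alpha (fun i => - u i).
  by rewrite -combN /comb -sumrN; apply: eq_bigr => i _; rewrite mulNrz.
split=> [u u0 i|u|i|i].
- have /(_ i) : forall i, - u i = 0; last by move/eqP; rewrite oppr_eq0 => /eqP.
  by apply: indep; rewrite -[RHS]u0; apply: eq_bigr => k _; rewrite scaleNr scalerN.
- rewrite combE => /sgn[] u_sgn; [right|left] => i; have := u_sgn i.
    by rewrite oppr_ge0.
  by rewrite oppr_le0.
- by rewrite opp_lfunE linearN /= opprK ah.
have [ei fi hE] := efh i; split=> //; first by rewrite opprK.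
by rewrite linearN /= hE -bracketC.
Qed.

Section Connected.
Variables (K : numFieldType) (g : lieAlgType K) (H : {vspace g}) (I : finType).
Variables (alpha : I -> dual H) (h : I -> subvs_of H) (e f : I -> g).
Hypotheses (g_simple : simple_lie g) (H_cartan : cartan_subalgebra H)
  (datum : root_datum alpha h e f)
  (root_comb : forall beta, is_root beta -> exists u, beta = comb alpha u).
Variables (n : I -> I -> nat) (x : I -> nat) (S : {set I}).
Hypotheses (nE : forall i j, i != j -> alpha j (h i) = - (n i j)%:R)
  (x_gt0 : forall i, (0 < x i)%N)
  (x_sub : forall i, (\sum_(j | j != i) n i j * x j < 2 * x i)%N)
  (S_cut : forall i j, i \in S -> j \notin S -> n i j = 0%N).

Definition supported (gamma : dual H) :=
  exists2 u, gamma = comb alpha u & forall j, j \notin S -> u j = 0.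

Lemma supportedPn u : ~ supported (comb alpha u) -> exists2 j, j \notin S & u j != 0.
Proof.
move=> not_u; apply/exists_inP; apply: contra_notT not_u => /exists_inPn uS.
by exists u => // j /uS/negPn/eqP.
Qed.

Lemma supported_cancel beta gamma :
  supported beta -> supported (beta + gamma) -> supported gamma.
Proof.
case=> u -> uS [v vE vS]; exists (fun i => v i - u i); last by move=> j jS; rewrite uS // vS.
by rewrite -combD -combN -vE [_ + gamma]addrC addrK.
Qed.

(** If [gamma] is a positive root, a nonzero bracket would have a root meeting both [S] and its
    complement. If it is negative, either its coefficient at [i] is 0 and [alpha i + gamma] has
    mixed signs, or [gamma] itself meets both sides, which is excluded after negating the root
    datum. *)
Lemma simple_root_commutes i gamma z : i \in S ->
  ~ supported gamma -> root_space gamma z -> bracket (e i) z = 0.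
Proof.
move=> iS ngamma gz; have [->|z_neq0] := eqVneq z 0; first by rewrite linear0.
have gamma_root : is_root gamma.
  split; last by exists z.
  by apply/eqP=> gamma0; apply: ngamma; exists (fun=> 0); rewrite ?comb0.
have [u uE] := root_comb gamma_root; rewrite {}uE in gamma_root ngamma gz.
have [j jS uj] := supportedPn ngamma.
have [_ sgn _ /(_ i)[ei _ _]] := datum.
have ji : j != i by apply: contraNneq jS => ->.
have := root_space_bracket ei gz; rewrite {1}[alpha i](comb_delta alpha) combD => ez.
have [u_ge0|u_le0] := sgn u gamma_root.
  apply: contrapT => /eqP ez_neq0.
  apply: (@no_mixed_root _ _ _ _ _ _ _ _ datum n x S nE x_gt0 x_sub S_cut
    (fun k => (k == i) + `|u k|)%N (bracket (e i) z) i j) => //.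
  - move: ez; congr root_space; apply: eq_bigr => k _.
    by rewrite PoszD gez0_abs.
  - by rewrite eqxx.
  - by rewrite addn_gt0 absz_gt0 uj orbT.
have [ui|ui] := eqVneq (u i) 0.
  apply: (root_space_mixed_sign datum (i := i) (j := j) ez); first by rewrite eqxx ui.
  by rewrite (negPf ji) add0r lt_neqAle uj u_le0.
have [] := @no_mixed_root _ _ _ _ _ _ _ _ (root_datumN datum) n x S _ x_gt0 x_sub S_cut
    (fun k => `|u k|)%N z i j => //.
- by move=> k l kl; rewrite opp_lfunE linearN /= opprK nE.
- move: gz; congr root_space; apply: eq_bigr => k _.
  by rewrite lez0_abs // mulNrz mulrNz opprK.
- by rewrite absz_gt0.
by rewrite absz_gt0.
Qed.

Lemma cut_trivial i j : i \in S -> j \notin S -> False.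
Proof.
move=> iS jS.
pose P v := forall gamma z, ~ supported gamma -> root_space gamma z -> bracket v z = 0.
have [] := @prop_subspace _ g P.
- by move=> gamma z _ _; rewrite bracket0l.
- move=> a u v Pu Pv gamma z ng gz.
  by rewrite bracketDl bracketZl (Pu gamma) // (Pv gamma) // scaler0 addr0.
move=> U UP; have U_ideal : is_ideal U.
  move=> w v /UP Pv; apply: (weight_ind H_cartan (Q := fun w => bracket w v \in U)).
  - by rewrite bracket0l mem0v.
  - by move=> y z yU zU; rewrite bracketDl memvD.
  (* For unsupported [beta] the bracket with [v] is zero by [P]. For supported [beta] the Jacobi
     identity applies, since [beta + gamma] is again unsupported. *)
  move=> beta y by_; have [beta_supp|nbeta] := pselect (supported beta); last first.
    by rewrite bracketC (Pv beta) // oppr0 mem0v.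
  apply/UP => gamma z ng gz; have := bracket_deriv y v z.
  rewrite (Pv _ _ ng gz) linear0 (Pv (beta + gamma)) ?addr0 //.
    by move=> /(supported_cancel beta_supp).
  exact: root_space_bracket.
have eU : e i \in U by apply/UP => gamma z; apply: simple_root_commutes.
have [indep _ ah /(_ j)[ej _ _]] := datum.
have [U0|Ufull] := (g_simple.2 U U_ideal).
  by have := e_neq0 datum i; rewrite U0 memv0 in eU; rewrite eU.
(* The ideal is proper: [h j] does not commute with [e j], whose weight [alpha j] is not supported
   in [S]. *)
have /UP/(_ _ _ _ ej) : vsval (h j) \in U by rewrite Ufull memvf.
rewrite ej ah => hj0; have /eqP : 2%:R *: e j = 0.
  apply: hj0 => -[u /esym]; rewrite (comb_delta alpha) => /(comb_inj indep)/(_ j) uj uS.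
  by rewrite uS ?eqxx in uj.
by rewrite scaler_eq0 pnatr_eq0 (negPf (e_neq0 datum j)).
Qed.
End Connected.

(** * The families *)

Section Listing.
Variables (K : nzRingType) (I : finType) (c : I -> I -> K) (d : I -> nat).
Variables (n : I -> I -> nat) (kap x : I -> nat).
Hypotheses (c_diag : forall u, c u u = 2%:R)
  (cE : forall u v, u != v -> c u v = - (n u v)%:R).

(** Lists are indexed from 0 and simple roots are numbered from 1, whence the [r.-1]; the diagonal
    is supplied by [c_diag]. *)
Lemma realizes_numbering M L v0 : realizes n M L ->
  all (fun r => nth 0 (nth [::] M r) r == 2) (iota 0 (size M)) ->
  numbering c M (fun r => nth v0 L r.-1).
Proof.
case=> L_uniq L_full sizeL entries /allP M_diag; split.
- move=> [|r] [|t] //; rewrite !inE /= -sizeL => rL tL /eqP.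
  by rewrite nth_uniq // => /eqP->.
- move=> u; exists (index u L).+1; last by rewrite /= nth_index ?L_full.
  by rewrite /= -sizeL index_mem L_full.
move=> [|r] [|t] //= rM tM; have [<-|rt] := eqVneq r t.
  by rewrite c_diag (eqP (M_diag r _)) // mem_iota.
rewrite cE ?nth_uniq ?sizeL // -[nth 0 _ t]opprK -(entries v0) //.
by rewrite mulrNz -pmulrn.
Qed.

Variables (A B A2 : Uqm c d).
Hypotheses
  (AE : forall r, uniq r -> (forall u, (u \in r) = (kap u == 3)) -> A = dprod c d x r)
  (BE : forall r, uniq r -> (forall u, (u \in r) = (kap u == 1)) -> B = dprod c d x r)
  (A2E : forall r, uniq r -> (forall u, (u \in r) = (kap u == 3)) ->
     A2 = dprod c d (fun u => 2 * x u)%N r).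

Lemma dprod1 (y : I -> nat) u : dprod c d y [:: u] = dpow c d u (y u).
Proof. by rewrite /dprod big_seq1. Qed.

Lemma dprod_rcons (y : I -> nat) r u :
  dprod c d y (rcons r u) = dprod c d y r * dpow c d u (y u).
Proof. by rewrite /dprod -cats1 big_cat big_seq1. Qed.

Lemma dprod2 (y : I -> nat) u v :
  dprod c d y [:: u; v] = dpow c d u (y u) * dpow c d v (y v).
Proof. by rewrite (dprod_rcons y [:: u]) dprod1. Qed.

Lemma dprod3 (y : I -> nat) u v w :
  dprod c d y [:: u; v; w] = dpow c d u (y u) * dpow c d v (y v) * dpow c d w (y w).
Proof. by rewrite (dprod_rcons y [:: u; v]) dprod2. Qed.

(** Filtering [L] by [kap] enumerates the two colour classes in the order of the numbering, so the
    products come out literally as each family writes them. *)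
Lemma classified_listed : classified n kap x -> listed c d (A * B * A) (A * B * A2 * B * A).
Proof.
case=> t tab [L [l [R l0 kL xL]]].
have [L_uniq L_full sizeL _] := R.
rewrite (AE (filter_uniq (fun u => kap u == 3) L_uniq)); last first.
  by move=> u; rewrite mem_filter L_full andbT.
rewrite (BE (filter_uniq (fun u => kap u == 1) L_uniq)); last first.
  by move=> u; rewrite mem_filter L_full andbT.
rewrite (A2E (filter_uniq (fun u => kap u == 3) L_uniq)); last first.
  by move=> u; rewrite mem_filter L_full andbT.
have num v0 := realizes_numbering v0 R.
clear R L_uniq L_full sizeL.
have mul24 : (2 * (2 * l) = 4 * l)%N by rewrite mulnA.
move: tab; rewrite !inE; do ![case/orP]; move/eqP=> tE; rewrite {}tE /= in kL xL num.
- case: L kL xL num => [|v1 [|v2 [|v3 [|v4 [|v5 [|w L]]]]]] //=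
    [k1 k2 k3 k4 k5] [x1 x2 x3 x4 x5] /(_ v1 isT) num.
  rewrite k1 k2 k3 k4 k5 /= !(dprod1, dprod2, dprod3)
    x1 x2 x3 x4 x5 ?muln1 ?[(l * _)%N]mulnC ?mul24.
  exact: (Family1 num l0 erefl erefl).
- case: L kL xL num => [|v1 [|v2 [|v3 [|v4 [|v5 [|w L]]]]]] //=
    [k1 k2 k3 k4 k5] [x1 x2 x3 x4 x5] /(_ v1 isT) num.
  rewrite k1 k2 k3 k4 k5 /= !(dprod1, dprod2, dprod3)
    x1 x2 x3 x4 x5 ?muln1 ?[(l * _)%N]mulnC ?mul24.
  exact: (Family2 num l0 erefl erefl).
- case: L kL xL num => [|v1 [|v2 [|v3 [|w L]]]] //=
    [k1 k2 k3] [x1 x2 x3] /(_ v1 isT) num.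
  rewrite k1 k2 k3 /= !(dprod1, dprod2, dprod3) x1 x2 x3 ?muln1 ?[(l * _)%N]mulnC ?mul24.
  exact: (Family3 num l0 erefl erefl).
- case: L kL xL num => [|v1 [|v2 [|v3 [|w L]]]] //=
    [k1 k2 k3] [x1 x2 x3] /(_ v1 isT) num.
  rewrite k1 k2 k3 /= !(dprod1, dprod2, dprod3) x1 x2 x3 ?muln1 ?[(l * _)%N]mulnC ?mul24.
  exact: (Family4 num l0 erefl erefl).
- case: L kL xL num => [|v1 [|v2 [|v3 [|w L]]]] //=
    [k1 k2 k3] [x1 x2 x3] /(_ v1 isT) num.
  rewrite k1 k2 k3 /= !(dprod1, dprod2, dprod3) x1 x2 x3 ?muln1 ?[(l * _)%N]mulnC ?mul24.
  exact: (Family5 num l0 erefl erefl).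
- case: L kL xL num => [|v1 [|v2 [|v3 [|w L]]]] //=
    [k1 k2 k3] [x1 x2 x3] /(_ v1 isT) num.
  rewrite k1 k2 k3 /= !(dprod1, dprod2, dprod3) x1 x2 x3 ?muln1 ?[(l * _)%N]mulnC ?mul24.
  exact: (Family6 num l0 erefl erefl).
- case: L kL xL num => [|v1 [|v2 [|v3 [|v4 [|w L]]]]] //=
    [k1 k2 k3 k4] [x1 x2 x3 x4] /(_ v1 isT) num.
  rewrite k1 k2 k3 k4 /= !(dprod1, dprod2, dprod3)
    x1 x2 x3 x4 ?muln1 ?[(l * _)%N]mulnC ?mul24.
  exact: (Family7 num l0 erefl erefl).
- case: L kL xL num => [|v1 [|v2 [|v3 [|v4 [|w L]]]]] //=
    [k1 k2 k3 k4] [x1 x2 x3 x4] /(_ v1 isT) num.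
  rewrite k1 k2 k3 k4 /= !(dprod1, dprod2, dprod3)
    x1 x2 x3 x4 ?muln1 ?[(l * _)%N]mulnC ?mul24.
  exact: (Family8 num l0 erefl erefl).
- case: L kL xL num => [|v1 [|v2 [|w L]]] //=
    [k1 k2] [x1 x2] /(_ v1 isT) num.
  rewrite k1 k2 /= !(dprod1, dprod2, dprod3) x1 x2 ?muln1 ?[(l * _)%N]mulnC ?mul24.
  exact: (Family9 num l0 erefl erefl).
- case: L kL xL num => [|v1 [|v2 [|w L]]] //=
    [k1 k2] [x1 x2] /(_ v1 isT) num.
  rewrite k1 k2 /= !(dprod1, dprod2, dprod3) x1 x2 ?muln1 ?[(l * _)%N]mulnC ?mul24.
  exact: (Family10 num l0 erefl erefl).
Qed.
End Listing.

(** * From simple roots and coroots to a root datum *)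

Section SimpleRoots.
Variables (K : numFieldType) (g : lieAlgType K) (H : {vspace g}) (I : finType).
Variables (alpha : I -> dual H) (h : I -> subvs_of H).
Hypotheses (alpha_simple : simple_roots alpha)
  (h_coroot : forall i, is_coroot (alpha i) (h i)).

Lemma simple_roots_independent : independent alpha.
Proof.
case: alpha_simple => /basis_free + _ _ => /(@freeP _ _ _ (codom_tuple alpha)) free_alpha u u0 i.
have := free_alpha (fun k => u (enum_val k)); rewrite -(enum_rankK i); apply.
rewrite -[RHS]u0 (big_enum_val _ (A := I)) /=; apply: eq_bigr => k _.
by rewrite nth_codom.
Qed.

Lemma root_comb_nat beta : is_root beta -> exists m : I -> nat,
  beta = comb alpha (fun i => (m i)%:Z) \/ beta = comb alpha (fun i => - (m i)%:Z).
Proof.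
case: alpha_simple => _ _ /[apply] -[m bE]; exists m.
by rewrite -combN; case: bE => ->; [left|right].
Qed.

Lemma root_comb beta : is_root beta -> exists u, beta = comb alpha u.
Proof. by case/root_comb_nat=> m []->; eexists. Qed.

Lemma simple_roots_datum : exists e f, root_datum alpha h e f.
Proof.
have /choice[e /choice[f efP]] i : exists e f, [/\ root_space (alpha i) e,
    root_space (- alpha i) f & vsval (h i) = bracket e f].
  by have [_ [e [f efP]]] := h_coroot i; exists e, f.
exists e, f; split=> // [|u|i]; first exact: simple_roots_independent.
  case/root_comb_nat=> m [] /(comb_inj simple_roots_independent) uE; [left|right] => i.
    by rewrite uE.
  by rewrite uE oppr_le0.
by have [] := h_coroot i.
Qed.

(** Without simple roots there are no roots, so [g] equals [H] and is abelian. This provides the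
    starting node of the classification. *)
Lemma simple_root_exists : cartan_subalgebra H -> simple_lie g -> inhabited I.
Proof.
move=> H_cartan [[x [y xy]] _]; apply: contrapT => I0.
have zH z : z \in H.
  apply: (weight_ind H_cartan (Q := fun z => z \in H)); [exact: mem0v|exact: memvD|].
  move=> beta v bv; have [->|v_neq0] := eqVneq v 0; first exact: mem0v.
  have [beta0|beta_neq0] := eqVneq beta 0.
    by apply/(root_space0 H_cartan); rewrite -beta0.
  have [|u uE] := @root_comb beta; first by split=> //; exists v.
  move: beta_neq0; rewrite uE /comb big1 ?eqxx // => i.
  by case: I0.
by rewrite (cartan_abelian H_cartan) ?eqxx ?zH in xy.
Qed.

End SimpleRoots.

Lemma sum_two_families (I : finType) p q (i : 'I_p -> I) (j : 'I_q -> I) (F : I -> nat) :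
  injective i -> injective j ->
  [set i k | k : 'I_p] :|: [set j k | k : 'I_q] = [set: I] ->
  [disjoint [set i k | k : 'I_p] & [set j k | k : 'I_q]] ->
  (\sum_u F u = \sum_k F (i k) + \sum_k F (j k))%N.
Proof.
move=> i_inj j_inj cover disj.
rewrite (bigID (mem [set i k | k : 'I_p])) /= big_imset; last by move=> ? ? _ _ /i_inj.
congr (_ + _)%N.
rewrite -(big_imset _ (in2W j_inj)) /=; apply: eq_bigl => u.
have : u \in [set: I] by rewrite inE.
rewrite -cover in_setU; case: (boolP (u \in _)) => //= ui _.
by rewrite (disjointFr disj ui).
Qed.

Theorem theorem4p3 (R : realType) (g : lieAlgType R[i]) (g_simple : simple_lie g)
    (H : {vspace g}) (H_cartan : cartan_subalgebra H)
    (I : finType) (alpha : I -> dual H) (alpha_simple : simple_roots alpha)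
    (h : I -> subvs_of H) (h_coroot : forall i, is_coroot (alpha i) (h i))
    (form : {symmetric (dual H)}) (d : I -> nat)
    (form_inv : invariant_form alpha h form d)
    (p q : nat) (i : 'I_p -> I) (j : 'I_q -> I)
    (i_inj : injective i) (j_inj : injective j)
    (a : 'I_p -> nat) (b : 'I_q -> nat)
    (a_gt0 : forall k, (0 < a k)%N) (b_gt0 : forall k, (0 < b k)%N)
    (P1 : [set i k | k : 'I_p] :|: [set j k | k : 'I_q] = [set: I] /\
          [disjoint [set i k | k : 'I_p] & [set j k | k : 'I_q]])
    (P2 : (forall r s : 'I_p, (r < s)%N -> form (alpha (i r)) (alpha (i s)) = 0) /\
          (forall r s : 'I_q, (r < s)%N -> form (alpha (j r)) (alpha (j s)) = 0))
    (P3 : forall k : 'I_p,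
       (3 * a k)%:R + \sum_(t < q) pairing alpha h (i k) (j t) * (b t)%:R = 0)
    (P4 : forall k : 'I_q,
       (b k)%:R + \sum_(t < p) pairing alpha h (j k) (i t) * (a t)%:R = 0) :
  let c := pairing alpha h in
  let theta := dmono c d i a * dmono c d j b * dmono c d i a in
  let xi := dmono c d i a * dmono c d j b * dmono c d i (fun k => 2 * a k)%N
            * dmono c d j b * dmono c d i a in
  listed c d theta xi.
Proof.
have [cover disj] := P1.
have [e [f datum]] := simple_roots_datum alpha_simple h_coroot.
move=> c /=.
have c_diag u : c u u = 2%:R by case: datum => _ _ ah _; exact: ah.
have /choice[N NE] (uv : I * I) : exists k, uv.1 != uv.2 -> c uv.1 uv.2 = - k%:R.
  have [->|uv12] := eqVneq uv.1 uv.2; first by exists 0%N.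
  by have [k kE] := cartan_int datum uv12; exists k.
(* The diagonal is set to 0, so that (P3) and (P4) become an equation in [n] over all nodes. *)
pose n u v := if u == v then 0%N else N (u, v).
have cE u v : u != v -> c u v = - (n u v)%:R.
  by move=> uv; rewrite /n (negPf uv) (NE (u, v)).
have [_ cform d_pos] := form_inv.
have d_gt0 u : (0 < d u)%N by have [] := d_pos u.
have form_neq0 u : form (alpha u) (alpha u) != 0.
  by have [du ->] := d_pos u; rewrite pnatr_eq0 muln_eq0 /= -lt0n.
(* The zero pattern of [n] is that of a symmetric form: this gives [n_sym0] and turns (P2) into
   vanishing of [n] within each colour class. *)
have form0 u v : u != v -> (n u v == 0%N) = (form (alpha u) (alpha v) == 0).
  move=> uv; have -> : (n u v == 0%N) = (c u v == 0) by rewrite cE // oppr_eq0 pnatr_eq0.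
  by rewrite /c /pairing cform !mulf_eq0 invr_eq0 (negPf (form_neq0 u)) pnatr_eq0 orbF.
have formC u v : form u v = form v u by rewrite hermC expr0 mul1r.
have n_diag u : n u u = 0%N by rewrite /n eqxx.
have n_sym0 u v : n u v = 0%N -> n v u = 0%N.
  have [->//|uv /eqP] := eqVneq u v; rewrite form0 // => /eqP fuv.
  by apply/eqP; rewrite form0 1?eq_sym // formC fuv.
have n_ii k l : n (i k) (i l) = 0%N.
  have [<-|kl] := eqVneq k l; first exact: n_diag.
  apply/eqP; rewrite form0 ?(inj_eq i_inj) //; apply/eqP.
  have [|lk|/val_inj kl'] := ltngtP k l; [exact: P2.1| |by rewrite kl' eqxx in kl].
  by rewrite formC; exact: P2.1.
have n_jj k l : n (j k) (j l) = 0%N.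
  have [<-|kl] := eqVneq k l; first exact: n_diag.
  apply/eqP; rewrite form0 ?(inj_eq j_inj) //; apply/eqP.
  have [|lk|/val_inj kl'] := ltngtP k l; [exact: P2.2| |by rewrite kl' eqxx in kl].
  by rewrite formC; exact: P2.2.
have i_set k : i k \in [set i k | k : 'I_p] by apply: imset_f.
have j_set k : j k \in [set j k | k : 'I_q] by apply: imset_f.
have ij k l : i k != j l.
  by apply: contraTneq (i_set k) => ->; rewrite (disjointFl disj).
pose kap u := if u \in [set i k | k : 'I_p] then 3%N else 1%N.
have kap_i k : kap (i k) = 3%N by rewrite /kap i_set.
have kap_j k : kap (j k) = 1%N by rewrite /kap (disjointFl disj).
have nodeP u : (exists k, u = i k) \/ (exists k, u = j k).
  have : u \in [set: I] by rewrite inE.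
  by rewrite -cover => /setUP[] /imsetP[k _ ->]; [left|right]; exists k.
(* By injectivity and disjointness exactly one index contributes at each node, so [x] glues [a] and
   [b] into one vector. *)
pose x u := (\sum_(k | i k == u) a k + \sum_(k | j k == u) b k)%N.
have x_i k : x (i k) = a k.
  rewrite /x [X in (_ + X)%N]big1 => [|l]; last by rewrite eq_sym (negPf (ij _ _)).
  by rewrite addn0 (big_pred1 k) // => l; rewrite (inj_eq i_inj).
have x_j k : x (j k) = b k.
  rewrite /x big1 => [|l]; last by rewrite (negPf (ij _ _)).
  by rewrite add0n (big_pred1 k) // => l; rewrite (inj_eq j_inj).
have x_gt0 u : (0 < x u)%N by case: (nodeP u) => -[k ->]; rewrite ?x_i ?x_j.
have kap_gt0 u : (0 < kap u)%N by rewrite /kap; case: ifP.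
have kap_adj u v : (0 < n u v)%N -> (kap u * kap v = 3)%N.
  by case: (nodeP u) (nodeP v) => -[k ->] [] [l ->]; rewrite ?n_ii ?n_jj // ?kap_i ?kap_j.
have x_eq v : (kap v * x v = \sum_u n v u * x u)%N.
  rewrite (sum_two_families _ i_inj j_inj cover disj).
  apply/eqP; rewrite -(eqr_nat R[i]) natrD !natr_sum.
  case: (nodeP v) => -[k ->].
  - rewrite [X in _ == X + _]big1 => [|l _]; last by rewrite n_ii.
    rewrite add0r kap_i x_i; apply/eqP/subr0_eq; rewrite -sumrN.
    apply: etrans (P3 k); congr (_ + _).
    by apply: eq_bigr => l _; rewrite -/c cE // x_j natrM mulNr.
  rewrite [X in _ == _ + X]big1 => [|l _]; last by rewrite n_jj.
  rewrite addr0 kap_j x_j mul1n; apply/eqP/subr0_eq; rewrite -sumrN.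
  apply: etrans (P4 k); congr (_ + _).
  by apply: eq_bigr => l _; rewrite -/c cE 1?eq_sym // x_i natrM mulNr.
have conn (S : {set I}) : S != set0 ->
    (forall u v, u \in S -> (0 < n u v)%N -> v \in S) -> S = setT.
  case/set0Pn=> u uS S_closed; apply/setP=> v; rewrite inE; apply: contrapT => /negP vS.
  (* The rescaled vector is used because [cut_trivial] needs strict inequalities at every node. *)
  apply: (cut_trivial g_simple H_cartan datum (root_comb alpha_simple) cE
    (rescaled_gt0 kap x_gt0) (rescaled_sub x_gt0 kap_adj x_eq kap_gt0) _ uS vS).
  move=> r s rS sS; apply/eqP; rewrite -leqn0 leqNgt; apply/negP => nrs.
  by rewrite (S_closed r s) in sS.
have [v0] := simple_root_exists alpha_simple H_cartan g_simple.
have c0_i k l : k != l -> c (i k) (i l) = 0.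
  by move=> kl; rewrite cE ?(inj_eq i_inj) // n_ii oppr0.
have c0_j k l : k != l -> c (j k) (j l) = 0.
  by move=> kl; rewrite cE ?(inj_eq j_inj) // n_jj oppr0.
have codom_i u : (kap u == 3%N) = (u \in codom i).
  case: (nodeP u) => -[k ->]; rewrite ?kap_i ?kap_j ?codom_f //.
  by apply/esym/negbTE/codomP=> -[l]; apply/eqP; rewrite eq_sym.
have codom_j u : (kap u == 1%N) = (u \in codom j).
  case: (nodeP u) => -[k ->]; rewrite ?kap_i ?kap_j ?codom_f //.
  by apply/esym/negbTE/codomP=> -[l]; apply/eqP.
apply: (classified_listed c_diag cE (kap := kap) (x := x)); last first.
- exact: classification n_sym0 x_gt0 kap_adj x_eq kap_gt0 conn v0.
- move=> r r_uniq rE; apply: dmonoE => // [k|u]; first by rewrite x_i.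
  by rewrite rE codom_i.
- move=> r r_uniq rE; apply: dmonoE => // u.
  by rewrite rE codom_j.
move=> r r_uniq rE; apply: dmonoE => // u.
by rewrite rE codom_i.
Qed.
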